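(* Let $U\subset V$ be a star-shaped open neighbourhood of $0$ in a vector space $V$, equipped with a Riemannian metric written in geodesic normal coordinates at $0$. Define noncommutative polynomials $\tilde Q_k$ in free variables $\mathcal{R}^0,\mathcal{R}^1,\mathcal{R}^2,\ldots$ recursively by $\tilde Q_0=\mathrm{Id}_V$ (the unit), $\tilde Q_1=0$ and, for $k\ge0$, $$\tilde Q_{k+2}=-\frac{k+1}{k+3}\sum_{j=0}^k\binom{k}{j}\,\mathcal{R}^j\,\tilde Q_{k-j}.$$ Then for all $k\ge0$ and all $X,Y\in V$, $$\nabla^k_{X,\ldots,X}Y\big|_0=\tilde Q_k\big(\mathcal{R}^0(X),\mathcal{R}^1(X),\ldots\big)\,Y\big|_0,$$ where on the left $Y$ is regarded as the constant vector field on $U$ with value $Y$. Equivalently, $\frac1{k!}\tilde Q_k(\mathcal{R}^0|_0,\mathcal{R}^1|_0,\ldots)$ is the $k$th coefficient (the homogeneous part of degree $k$ in $X$) of the Taylor expansion at $0$ of the backward parallel transport map $\Phi^{-1}\colon U\to\mathrm{GL}(V)$.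
   Context: ''Riemannian metric'' means a smooth nondegenerate symmetric $(0,2)$-tensor field (any signature). A metric on a star-shaped open neighbourhood $U$ of the origin of $V$ is given in geodesic normal coordinates if the straight lines $t\mapsto tX$, $t\in[0,1]$, are geodesics for all $X\in U$. $\nabla$ is the Levi-Civita connection, $\mathrm{R}(X,Y)Z=\nabla_X\nabla_YZ-\nabla_Y\nabla_XZ-\nabla_{[X,Y]}Z$, and iterated covariant derivatives are $\nabla^{k+1}_{Z,X_1,\ldots,X_k}\psi=\nabla_Z\nabla^k_{X_1,\ldots,X_k}\psi-\sum_i\nabla^k_{X_1,\ldots,\nabla_ZX_i,\ldots,X_k}\psi$, $\nabla^0\psi=\psi$. The symmetrized $k$th covariant derivative of curvature is $\mathcal{R}^k(X)Y=\nabla^k_{X,\ldots,X}\mathrm{R}(Y,X)X$; its value at $0\in V$, $\mathcal{R}^k|_0$, is a homogeneous polynomial of degree $k+2$ on $V$ with values in $\mathrm{End}(V)$. The $\tilde Q_k$ are elements of the unital associative free $\mathbb{R}$-algebra $\mathbb{R}\langle\mathcal{R}^0,\mathcal{R}^1,\ldots\rangle$; they are evaluated by substituting for the free variable $\mathcal{R}^j$ the endomorphism $\mathcal{R}^j(X)|_0$ of $V$, products becoming compositions and the unit becoming $\mathrm{Id}_V$. The backward parallel transport map assigns to $X\in U$ the parallel transport (for $\nabla$) along the ray $\gamma_X(t)=tX$ from $t=1$ back to $t=0$, $\Phi^{-1}(X)\colon T_XU\to T_0U$, regarded as an element of $\mathrm{GL}(V)$ via the canonical identifications $T_XU\cong V\cong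 T_0U$. *)

(* Defs.v *)
From HB Require Import structures.
From mathcomp Require Import all_boot all_order all_algebra.
(* The notations of [monalg] clash with those of the analysis library. *)
From mathcomp Require finmap.
From mathcomp.multinomials Require monalg.
Import -(notations) monalg.
From mathcomp Require Import all_classical all_reals.
From mathcomp Require Import topology normedtype landau derive.

Set Implicit Arguments.
Unset Strict Implicit.
Unset Printing Implicit Defensive.

Import Order.TTheory GRing.Theory Num.Theory.
Import numFieldNormedType.Exports.

Local Open Scope classical_set_scope.
Local Open Scope ring_scope.

(** Everything takes place in a finite-dimensional real vector space [V].  It
    carries a norm because the library's differential calculus is developed on
    normed modules; in finite dimension no notion below depends on that norm.
    The tangent spaces of [V] are identified with [V], so that vector fields
    are functions [V -> V], considered only on an open set [U]. *)

Definition finite_dim (R : realType) (V : normedModType R) : Prop :=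
  exists (n : nat) (e : 'I_n -> V),
    forall v, exists c : 'I_n -> R, v = \sum_i c i *: e i.

Section Calculus.
Context {R : realType} {V W : normedModType R}.

(* [iter_derive [:: v1; ..; vk] f] is 'D_v1 (.. ('D_vk f)). *)
Definition iter_derive (vs : seq V) (f : V -> W) : V -> W :=
  foldr (fun v h x => 'D_v h x) f vs.

(* On a finite-dimensional [V] this is the usual notion of C^oo function. *)
Definition smooth_on (U : set V) (f : V -> W) : Prop :=
  forall (vs : seq V) (x : V), U x -> differentiable (iter_derive vs f) x.

(* The homogeneous part of degree [k] of the Taylor series at 0 of [f],
   D^k f(0)(X, .., X) / k!. *)
Definition taylor_part (f : V -> W) (k : nat) (X : V) : W :=
  k`!%:R^-1 *: iter_derive (nseq k X) f 0.

(* Since 'D_v is a total operator, the existence of the derivatives has to be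
   required separately. *)
Definition has_taylor_expansion (f : V -> W) (p : nat -> V -> W) : Prop :=
  [/\ forall k X, \forall t \near (0 : R),
        derivable (iter_derive (nseq k X) f) (t *: X) X,
      forall k X, taylor_part f k X = p k X
    & forall N, (fun X => f X - \sum_(k < N.+1) p k X) =o_0
                (fun X => `|X| ^+ N : R^o)].

End Calculus.

Section Geometry.
Context {R : realType} {V : normedModType R}.
Implicit Types (U : set V) (g : V -> V -> V -> R) (Gamma : V -> V -> V -> V).

Definition star_shaped U : Prop :=
  forall x (t : R), U x -> 0 <= t <= 1 -> U (t *: x).

Definition bilinear_map (W : lmodType R) (b : V -> V -> W) : Prop :=
  (forall u, linear (b u)) /\ (forall v, linear (b^~ v)).

(* [g x u v] is the value g_x(u, v). *)
Record riemannian_metric U g : Prop := RiemannianMetric {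
  metric_bilinear : forall x, U x -> bilinear_map (W := R^o) (g x);
  metric_symmetric : forall x u v, U x -> g x u v = g x v u;
  metric_nondegenerate :
    forall x u, U x -> (forall v, g x u v = 0) -> u = 0;
  metric_smooth : forall u v, smooth_on (W := R^o) U (fun x => g x u v)
}.

Notation vfield := (V -> V).

Definition lie_bracket (A B : vfield) : vfield :=
  fun x => 'D_(A x) B x - 'D_(B x) A x.

(* A connection on the trivialized bundle TU = U x V is nabla = d + Gamma,
   with Gamma a smooth field of bilinear maps V x V -> V. *)
Record connection U Gamma : Prop := Connection {
  connection_bilinear : forall x, U x -> bilinear_map (Gamma x);
  connection_smooth : forall u v, smooth_on U (fun x => Gamma x u v)
}.

Definition nabla Gamma (A B : vfield) : vfield :=
  fun x => 'D_(A x) B x + Gamma x (A x) (B x).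

Record levi_civita U g Gamma : Prop := LeviCivita {
  levi_civita_connection : connection U Gamma;
  levi_civita_torsion_free : forall A B : vfield,
    smooth_on U A -> smooth_on U B -> forall x, U x ->
    nabla Gamma A B x - nabla Gamma B A x = lie_bracket A B x;
  levi_civita_metric : forall A B C : vfield,
    smooth_on U A -> smooth_on U B -> smooth_on U C -> forall x, U x ->
    'D_(C x) (fun y => g y (A y) (B y) : R^o) x =
      g x (nabla Gamma C A x) (B x) + g x (A x) (nabla Gamma C B x)
}.

Definition nabla_along Gamma (c W : R -> V) : R -> V :=
  fun t => derive1 W t + Gamma (c t) (derive1 c t) (W t).

Definition parallel_along Gamma (c W : R -> V) : Prop :=
  forall t : R, 0 <= t <= 1 ->
    derivable W t 1 /\ nabla_along Gamma c W t = 0.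

Definition geodesic Gamma (c : R -> V) : Prop :=
  (forall t : R, 0 <= t <= 1 -> derivable c t 1) /\
  parallel_along Gamma c (derive1 c).

Definition ray (X : V) : R -> V := fun t => t *: X.

Definition normal_coordinates U Gamma : Prop :=
  forall X, U X -> geodesic Gamma (ray X).

(* [Phi_inv X Y] is the value at 0 of the parallel vector field along the ray of
   [X] whose value at time 1 is [Y]. *)
Definition backward_parallel_transport U Gamma (Phi_inv : V -> V -> V) : Prop :=
  forall X Y, U X -> exists W : R -> V,
    [/\ parallel_along Gamma (ray X) W, W 1 = Y & W 0 = Phi_inv X Y].

(* Iterated covariant derivatives of a section [psi] of a vector bundle with
   connection: [S] is the space of sections and [D Z] the covariant derivative
   in the direction of the vector field [Z]. *)
Fixpoint iter_nabla Gamma (S : zmodType) (D : vfield -> S -> S) (psi : S)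
    (k : nat) : ('I_k -> vfield) -> S :=
  match k with
  | 0 => fun=> psi
  | k'.+1 => fun X =>
      let Z := X ord0 in
      let X' (i : 'I_k') := X (lift ord0 i) in
      D Z (iter_nabla Gamma D psi X')
      - \sum_(i < k') iter_nabla Gamma D psi
          (fun j => if j == i then nabla Gamma Z (X' i) else X' j)
  end.

(* Tensor fields of type (1,3) as operators on vector fields. *)
Notation tensor13 := (vfield -> vfield -> vfield -> vfield).

Definition nabla13 Gamma (Z : vfield) (T : tensor13) : tensor13 :=
  fun A B C => nabla Gamma Z (T A B C) - T (nabla Gamma Z A) B C
             - T A (nabla Gamma Z B) C - T A B (nabla Gamma Z C).

Definition curvature Gamma : tensor13 := fun A B C =>
  nabla Gamma A (nabla Gamma B C) - nabla Gamma B (nabla Gamma A C)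
  - nabla Gamma (lie_bracket A B) C.

(* The value at 0 of R^k(X)Y = (nabla^k_{X,..,X} R)(Y, X)X. *)
Definition symm_nabla_curvature Gamma (k : nat) (X Y : V) : V :=
  iter_nabla Gamma (nabla13 Gamma) (curvature Gamma) (k := k) (fun=> cst X)
    (cst Y) (cst X) (cst X) 0.

End Geometry.

(* The free algebra on variables indexed by [nat], as the algebra of the monoid
   of words in these variables. *)
Notation free_algebra R := (malg (fmonom nat) R).

Section FreeAlgebra.
Context {R : realType}.

Definition free_var (j : nat) : free_algebra R := mkmalgU (fmu j) 1.

Fixpoint Qtilde (k : nat) : free_algebra R :=
  match k with
  | 0 => 1
  | 1 => 0
  | k'.+2 => - (k'.+1%:R / k'.+3%:R) *:
      \sum_(j < k'.+1) 'C(k', j)%:R *: (free_var j * Qtilde (k' - j))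
  end.

Context {V : lmodType R}.

(* Evaluation of a noncommutative polynomial at [r 0, r 1, ..] in End(V): the
   word j1 j2 .. jm becomes the composite r j1 \o r j2 \o .. \o r jm. *)
Definition free_eval (r : nat -> V -> V) (p : free_algebra R) (Y : V) : V :=
  \sum_(w <- finmap.enum_fset (msupp p))
    mcoeff w p *: foldr r Y (fmonom_val w).

End FreeAlgebra.

(* Main.v *)
(** In normal coordinates the connection form satisfies Gamma_x(x, x) = 0, so the
    fields t Y along a ray t X are Jacobi fields: with N = nabla_X,
      2 N Y + t (N N Y + R(Y, X) X) = 0  at the point t X.
    Applying N repeatedly, setting t = 0 and expanding N^k (R(Y, X) X) by the
    Leibniz rule gives, for the vectors N^k Y at 0, the recursion that defines
    the polynomials Qtilde.  On the line R X only N matters, because nabla_X X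
    vanishes there.

    For the second part, differentiating backward parallel transport turns a
    field B into N B, so the radial derivatives of X |-> Phi^-1(X) Y are
    Phi^-1 (N^k Y); since |N^k Y| = O(|X|^k) near 0, Taylor's inequality along
    the segment from 0 to X gives the expansion. *)

(* The geometry enters through two facts about the connection form: [Gamma] is symmetric, and
   Gamma_x(x, x) = 0. Differentiating the latter in the direction Y at x = tX gives t^2 D_Y Gamma(X,
   X) + 2t Gamma(X, Y) = 0. Since D_Y Gamma(X, X) = N N Y + R(Y, X)X on the line, division by t
   gives the Jacobi equation. With w_k the value of N^k Y at 0, the factor t turns N^(m+1) of it
   into 2 w_(m+2) + (m+1)(w_(m+2) + N^m(R(Y, X)X)) = 0 at 0, whence the coefficient (m+1)/(m+3).

   Backward transport is given only pointwise, as one parallel field for each X and Y, with no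
   regularity in X. All its properties are extracted on a small ball, where a parallel field varies
   by at most half of its maximum. This gives uniqueness, linearity and injectivity; finite
   dimension adds surjectivity, hence parallel fields with prescribed initial value, without an
   existence theorem for differential equations.

   The mean value theorem and the symmetry of second derivatives are proved for real functions and
   carried to V by the continuous coordinates of a dual frame. *)
Require Import Defs.
From HB Require Import structures.
From mathcomp Require Import all_boot all_order all_algebra.
From mathcomp.multinomials Require monalg.
Import -(notations) monalg.
From mathcomp Require Import all_classical all_reals.
From mathcomp Require Import topology normedtype landau derive.

Set Implicit Arguments.
Unset Strict Implicit.
Unset Printing Implicit Defensive.

Import Order.TTheory GRing.Theory Num.Theory.
Import numFieldNormedType.Exports.

Local Open Scope classical_set_scope.
Local Open Scope ring_scope.

(** * Smooth maps *)

Section Scale.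
Context {R : realType} {V W : normedModType R}.

Lemma scale_is_bilinear :
  bilinear_for (GRing.Scale.Law.clone _ _ *:%R _)
    (GRing.Scale.Law.clone _ _ *:%R _)
    (@GRing.scale R W : R^o -> W -> W).
Proof.
split=> [u'|u] a x y /=; first by rewrite scalerDl scalerA.
by rewrite scalerDr !scalerA mulrC.
Qed.

HB.instance Definition _ := @bilinear_isBilinear.Build R R^o W W _ _
  (@GRing.scale R W : R^o -> W -> W) scale_is_bilinear.

Lemma differentiable_scale (a : V -> R) (h : V -> W) x :
  differentiable (a : V -> R^o) x -> differentiable h x ->
  differentiable (fun y => a y *: h y) x.
Proof.
move=> da dh.
apply: (@differentiable_comp _ _ (R^o * W)%type _
  (fun y => (a y, h y)) (fun p => p.1 *: p.2)).
  exact: differentiable_pair.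
apply: (@differentiable_bilin _ R^o W W (@GRing.scale R W : R^o -> W -> W)).
exact: scale_continuous.
Qed.

Lemma is_derive_scale (a : V -> R) (h : V -> W) x v da dh :
  is_derive x v (a : V -> R^o) da -> is_derive x v h dh ->
  is_derive x v (fun y => a y *: h y) (da *: h x + a x *: dh).
Proof.
move=> [ia Da] [ih Dh].
suff H : (fun t => t^-1 *: (((fun y => a y *: h y) \o shift x) (t *: v)
     - a x *: h x)) @ 0^' --> da *: h x + a x *: dh.
  by split; [apply/cvg_ex; eexists; exact: H | exact: cvg_lim H].
rewrite addrC.
rewrite [X in X @ _](_ : _ = (fun t => a (t *: v + x) *: (t^-1 *: (h (t *: v +
  x) - h x)))
   \+ (fun t => (t^-1 *: (a (t *: v + x) - a x)) *: h x)); last first.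
  rewrite funeqE => t /=; rewrite scalerA [a _ * _]mulrC -!scalerA -scalerDr.
  by congr (_ *: _); rewrite scalerBr scalerBl addrA subrK.
apply: cvgD; last first.
  apply: cvgZr_tmp; rewrite -Da; exact: ia.
apply: cvgZ; last by rewrite -Dh; exact: ih.
have : {for 0, continuous (fun t : R => (a (t *: v + x) : R^o))}.
  exact/differentiable_continuous/derivable1_diffP/(derivable1P _ _ _).1.
by move=> /continuous_withinNx; rewrite scale0r add0r.
Qed.

End Scale.

Section SmoothOn.
Context {R : realType} {V W : normedModType R}.
Implicit Types (U : set V) (f : V -> W).

(** Made for induction on the order: the derivative of a product is a sum of products of other
    functions, each smooth to one order less, whereas a fixed list of directions gives no such
    induction. *)
Fixpoint differentiable_upto (n : nat) U f : Prop :=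
  (forall x, U x -> differentiable f x) /\
  match n with
  | 0 => True
  | n'.+1 => forall v, differentiable_upto n' U (fun x => 'D_v f x)
  end.

Lemma iter_derive_rcons (vs : seq V) v f :
  iter_derive (rcons vs v) f = iter_derive vs (fun x => 'D_v f x).
Proof. by rewrite /iter_derive foldr_rcons. Qed.

Lemma smooth_on_derive U f v :
  smooth_on U f -> smooth_on U (fun x => 'D_v f x).
Proof. by move=> sf vs x Ux; rewrite -iter_derive_rcons; exact: sf. Qed.

Lemma smooth_on_diff U f x : smooth_on U f -> U x -> differentiable f x.
Proof. by move=> sf; exact: (sf [::]). Qed.

Lemma smooth_on_is_derive U f x v : smooth_on U f -> U x ->
  is_derive x v f ('D_v f x).
Proof. by move=> sf Ux; apply/derivableP/diff_derivable/(smooth_on_diff sf).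
  Qed.

Lemma smooth_onP U f : smooth_on U f <-> forall n, differentiable_upto n U f.
Proof.
split=> [sf n|df vs].
  elim: n f sf => [|n IH] f sf; split=> //; try exact: (fun x =>
    smooth_on_diff sf).
  by move=> v; apply: IH; exact: smooth_on_derive.
have: differentiable_upto (size vs) U f by exact: df.
elim/last_ind: vs {df} f => [|vs v IH] f; first by move=> /= -[].
rewrite size_rcons iter_derive_rcons => -[_ df]; exact: (IH _ (df v)).
Qed.

Lemma differentiable_uptoW n U f :
  differentiable_upto n.+1 U f -> differentiable_upto n U f.
Proof.
elim: n f => [|n IH] f [df Df]; split=> // v.
by apply: IH; exact: Df.
Qed.

Lemma derive_eq_on U f g x v : open U -> (forall y, U y -> f y = g y) -> U x ->
  'D_v f x = 'D_v g x.
Proof.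
move=> oU fg Ux; apply: near_eq_derive.
by near=> y; apply: fg; near: y; exact: open_nbhs_nbhs.
Unshelve. all: by end_near. Qed.

(** The first-order expansion of [f] at [x] holds for [g] as well, and uniqueness of the
    differential identifies ['d g x] with ['d f x]. *)
Lemma near_eq_differentiable (f g : V -> W) x :
  (\near x, f x = g x) -> differentiable f x -> differentiable g x.
Proof.
move=> fg df; apply/diff_locallyP.
have dgE : f x = g x by exact: nbhs_singleton fg.
have /diff_locally := df; rewrite funeqE => dfE.
suff H : g \o shift x = cst (g x) + 'd f x +o_ 0 id.
  have dgE' : 'd g x = 'd f x :> (V -> W) by apply: diff_unique => //;
    exact: diff_continuous.
  by split; rewrite dgE' //; exact: diff_continuous.
apply/eqaddoP => eps eps0.
have := diff_locally df; move=> /eqaddoP /(_ eps eps0).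
have fg0 : \forall h \near (0 : V), f (h + x) = g (h + x).
  by move/nbhs0P: fg; apply: filterS => h /=; rewrite addrC.
apply: filter_app; near=> h.
rewrite /= -![(_ + _ : _ -> _) _]/(_ + _) -![(- _ : _ -> _) _]/(- _) /= -dgE.
by rewrite (_ : f (h + x) = g (h + x)) //; near: h.
Unshelve. all: by end_near. Qed.

Lemma differentiable_upto_eq n U f g : open U -> (forall x, U x -> f x = g x) ->
  differentiable_upto n U f -> differentiable_upto n U g.
Proof.
move=> oU; elim: n f g => [|n IH] f g fg [df Df].
all: split; [move=> x Ux; apply: near_eq_differentiable (df x Ux)|].
all: try by near=> y; apply: fg; near: y; exact: open_nbhs_nbhs.
  by [].
move=> v; apply: IH (Df v) => x Ux; exact: derive_eq_on Ux.
Unshelve. all: by end_near. Qed.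

Lemma smooth_on_eq U f g : open U -> (forall x, U x -> f x = g x) ->
  smooth_on U f -> smooth_on U g.
Proof.
move=> oU fg /smooth_onP sf; apply/smooth_onP => n.
exact: differentiable_upto_eq (sf n).
Qed.

Lemma smooth_on_cst U (w : W) : smooth_on U (cst w).
Proof.
apply/smooth_onP => n; elim: n w => [|n IH] w; split=> //= v.
rewrite (_ : (fun x => _) = cst 0) //; apply/funext => x; exact: derive_cst.
Qed.

Lemma differentiable_uptoD n U f g : open U ->
  differentiable_upto n U f -> differentiable_upto n U g ->
  differentiable_upto n U (fun x => f x + g x).
Proof.
move=> oU; elim: n f g => [|n IH] f g [df Df] [dg Dg].
  by split=> // x Ux; apply: differentiableD; [exact: df|exact: dg].
split=> [x Ux|v]; first by apply: differentiableD; [exact: df|exact: dg].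
apply: differentiable_upto_eq (IH _ _ (Df v) (Dg v)) => // x Ux.
by rewrite deriveD //; apply: diff_derivable; [exact: df|exact: dg].
Qed.

Lemma smooth_onD U f g : open U -> smooth_on U f -> smooth_on U g ->
  smooth_on U (fun x => f x + g x).
Proof.
move=> oU /smooth_onP sf /smooth_onP sg; apply/smooth_onP => n.
exact: differentiable_uptoD.
Qed.

Lemma smooth_on_sum U (I : Type) (r : seq I) (f : I -> V -> W) : open U ->
  (forall i, smooth_on U (f i)) -> smooth_on U (fun x => \sum_(i <- r) f i x).
Proof.
move=> oU sf; elim: r => [|i r IH].
  apply: (smooth_on_eq oU _ (smooth_on_cst (0 : W))) => x _; by rewrite big_nil.
by apply: (smooth_on_eq oU _ (smooth_onD oU (sf i) IH)) => x _;
  rewrite big_cons.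
Qed.

Lemma derive_scale (a : V -> R) f x v :
  differentiable (a : V -> R^o) x -> differentiable f x ->
  'D_v (fun y => a y *: f y) x = 'D_v (a : V -> R^o) x *: f x + a x *: 'D_v f x.
Proof.
move=> da df; have H := @is_derive_scale _ _ _ a f x v _ _
  (derivableP (diff_derivable da)) (derivableP (diff_derivable df)).
exact: derive_val.
Qed.

End SmoothOn.

Lemma smooth_on_scale (R : realType) (V W : normedModType R) U (a : V -> R)
    (f : V -> W) : open U ->
  smooth_on (W := R^o) U a -> smooth_on U f ->
  smooth_on U (fun x => a x *: f x).
Proof.
move=> oU /smooth_onP sa /smooth_onP sf; apply/smooth_onP => n.
elim: n a f {sa sf} (sa n) (sf n) => [|n IH] a f [da Da] [df Df].
  by split=> // x Ux; apply: differentiable_scale; [exact: da|exact: df].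
split=> [x Ux|v]; first by apply: differentiable_scale; [exact: da|exact: df].
apply: (@differentiable_upto_eq _ _ _ _ _
  (fun x => 'D_v (a : V -> R^o) x *: f x + a x *: 'D_v f x)) => //.
  by move=> x Ux; rewrite derive_scale //; [exact: da|exact: df].
have a' : differentiable_upto n U (a : V -> R^o)
  by apply: differentiable_uptoW; split.
have f' : differentiable_upto n U f by apply: differentiable_uptoW; split.
by apply: differentiable_uptoD => //; apply: IH => //; [exact: Da|exact: Df].
Qed.

Lemma MVT_derive (R : realType) (f : R -> R) (a b : R) : a < b ->
  (forall t, a <= t <= b -> derivable f t 1) ->
  exists2 c, a < c < b & f b - f a = 'D_1 f c * (b - a).
Proof.
move=> ab df.
have [||c] := @MVT R f (fun t => 'D_1 f t) a b ab.
- move=> t; rewrite in_itv /= => /andP[at_ tb].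
  by apply/derivableP/df; rewrite !ltW.
- apply: derivable_within_continuous => t; rewrite in_itv /=; exact: df.
by rewrite in_itv /= => cab ->; exists c.
Qed.

(** * Symmetry of second derivatives *)

Section Schwarz.
Context {R : realType} {V : normedModType R}.
Implicit Types (U : set V).

Lemma near_parallelogram (P : set V) (x u v : V) : nbhs x P ->
  exists2 h : R, 0 < h & forall s t, 0 <= s <= h -> 0 <= t <= h ->
    P (s *: u + (t *: v + x)).
Proof.
move=> /nbhs_normP[/= r r0 rP].
have uv0 : 0 < `|u| + `|v| + 1 by rewrite ltr_wpDl ?addr_ge0.
(* The 1 keeps the denominator positive when [u] and [v] vanish; the factor 1/2 makes the last
   inequality strict. *)
exists (r / 2 / (`|u| + `|v| + 1)); first by rewrite !divr_gt0.
move=> s t /andP[s0 sh] /andP[t0 th]; apply: rP.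
rewrite /= addrA opprD addrCA subrr addr0 normrN.
rewrite (le_lt_trans (ler_normD _ _)) // !normrZ !ger0_norm //.
apply: (@le_lt_trans _ _ (r / 2 / (`|u| + `|v| + 1) * (`|u| + `|v|))).
  by rewrite mulrDr lerD // ler_wpM2r.
apply: (@le_lt_trans _ _ (r / 2)); last
  by rewrite ltr_pdivrMr // ltr_pMr // ltr1n.
rewrite -mulrA ler_piMr ?divr_ge0 ?(ltW r0) // mulrC.
by rewrite ler_pdivrMr // mul1r lerDl.
Qed.

Lemma is_derive_line (W : normedModType R) (f : V -> W) (u y : V) (t : R) df :
  is_derive (t *: u + y) u f df ->
  is_derive t (1 : R) (fun s => f (s *: u + y)) df.
Proof.
have E : (fun h : R => h^-1 *: (((fun s => f (s *: u + y)) \o shift t) (h *: 1)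
     - f (t *: u + y))) =
  (fun h => h^-1 *: ((f \o shift (t *: u + y)) (h *: u) - f (t *: u + y))).
  by apply/funext => h /=; rewrite [_%:A]mulr1 scalerDl addrA.
by move=> [df1 df2]; split; [rewrite /derivable E|rewrite /derive E].
Qed.

(** The mean value theorem is applied twice: along [u] to the increment of [f] over [h *: v], then
    along [v] to the derivative of [f] in the direction [u]. *)
Lemma second_difference U (f : V -> R) u v x h : open U ->
  smooth_on (W := R^o) U f -> 0 < h ->
  (forall s t, 0 <= s <= h -> 0 <= t <= h -> U (s *: u + (t *: v + x))) ->
  exists s t, [/\ 0 <= s <= h, 0 <= t <= h &
   f (h *: u + (h *: v + x)) - f (h *: u + x) - f (h *: v + x) + f x =
   'D_v (fun y => 'D_u (f : V -> R^o) y) (s *: u + (t *: v + x)) * h * h].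
Proof.
move=> oU sf h0 Uh.
have hh : 0 <= h <= h by rewrite lexx ltW.
have h00 : 0 <= (0 : R) <= h by rewrite lexx ltW.
have U0 s : 0 <= s <= h -> U (s *: u + x).
  by move=> sh; rewrite -[x]add0r -(scale0r v); exact: Uh.
have Dphi s : 0 <= s <= h ->
  is_derive s (1 : R) (fun s => f (s *: u + (h *: v + x)) - f (s *: u +
    x) : R^o)
   ('D_u (f : V -> R^o) (s *: u + (h *: v + x)) - 'D_u (f : V ->
     R^o) (s *: u + x)).
  move=> sh; apply: is_deriveB; apply: is_derive_line.
  - exact: (smooth_on_is_derive u sf (Uh _ _ sh hh)).
  - exact: (smooth_on_is_derive u sf (U0 _ sh)).
have [|s sh phiE] := @MVT_derive R
    (fun s => f (s *: u + (h *: v + x)) - f (s *: u + x)) 0 h h0.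
  by move=> t th; exact: (@ex_derive _ _ _ _ _ _ _ (Dphi t th)).
have {}sh : 0 <= s <= h by move: sh => /andP[? ?]; rewrite !ltW.
have Dpsi t : 0 <= t <= h ->
  is_derive t (1 : R) (fun t => 'D_u (f : V -> R^o) (t *: v + (s *: u +
    x)) : R^o)
   ('D_v (fun y => 'D_u (f : V -> R^o) y) (t *: v + (s *: u + x))).
  move=> th; apply: (is_derive_line (f := fun y => 'D_u (f : V -> R^o) y)).
  have Us : U (t *: v + (s *: u + x)) by rewrite addrCA; exact: Uh.
  exact: (smooth_on_is_derive v (smooth_on_derive u sf) Us).
have [|t th psiE] := @MVT_derive R
    (fun t => 'D_u (f : V -> R^o) (t *: v + (s *: u + x))) 0 h h0.
  by move=> t th; exact: (@ex_derive _ _ _ _ _ _ _ (Dpsi t th)).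
have {}th : 0 <= t <= h by move: th => /andP[? ?]; rewrite !ltW.
exists s, t; split=> //.
move: phiE; rewrite (@derive_val _ _ _ _ _ _ _ (Dphi s sh)) subr0.
rewrite scale0r add0r add0r => phiE.
move: psiE; rewrite (@derive_val _ _ _ _ _ _ _ (Dpsi t th)) subr0.
rewrite scale0r add0r => psiE.
rewrite [s *: u + (t *: v + x)]addrCA -psiE [h *: v + (s *: u + x)]addrCA -phiE.
by rewrite opprB [RHS]addrA [LHS]addrAC.
Qed.

(** The second difference is symmetric in [u] and [v]. Evaluating it in both orders equates the two
    mixed derivatives at two points close to [x], and their continuity at [x] does the rest. *)
Lemma derive_comm_real U (f : V -> R) u v x : open U ->
  smooth_on (W := R^o) U f -> U x ->
  'D_u (fun y => 'D_v (f : V -> R^o) y) x =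
  'D_v (fun y => 'D_u (f : V -> R^o) y) x.
Proof.
move=> oU sf Ux.
set g1 := (fun y => 'D_v _ y); set g2 := (fun y => 'D_u _ y).
have c1 : {for x, continuous (fun y => 'D_u g1 y)}.
  apply: differentiable_continuous; apply: (smooth_on_diff _ Ux).
  by do 2!apply: smooth_on_derive.
have c2 : {for x, continuous (fun y => 'D_v g2 y)}.
  apply: differentiable_continuous; apply: (smooth_on_diff _ Ux).
  by do 2!apply: smooth_on_derive.
apply/eqP; rewrite -subr_eq0 -normr_le0; apply/ler_addgt0Pr => e e0;
  rewrite add0r.
have e20 : 0 < e / 2 by rewrite divr_gt0.
have /cvgrPdist_lt/(_ _ e20) n1 := c1; have /cvgrPdist_lt/(_ _ e20) n2 := c2.
have nU := open_nbhs_nbhs (conj oU Ux).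
have [h h0 Ph] := near_parallelogram u v (filterI nU (filterI n1 n2)).
have [s1 [t1 [sh1 th1 E1]]] := second_difference oU sf h0 (fun s t sh th =>
  (Ph s t sh th).1).
have Ph' s t (sh : 0 <= s <= h) (th : 0 <= t <= h) : U (s *: v + (t *: u + x)).
  by rewrite addrCA; exact: (Ph _ _ _ _).1.
have [s2 [t2 [sh2 th2 E2]]] := second_difference oU sf h0 Ph'.
have lt1 := (Ph s1 t1 sh1 th1).2.2; have lt2 := (Ph t2 s2 th2 sh2).2.1.
rewrite [s2 *: v + _]addrCA in E2.
have hN0 := lt0r_neq0 h0.
have E : 'D_u g1 (t2 *: u + (s2 *: v + x)) = 'D_v g2 (s1 *: u + (t1 *: v + x)).
  apply: (mulIf hN0); apply: (mulIf hN0); apply: etrans (esym E2) _;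
    apply: etrans _ E1.
  by rewrite [h *: v + (h *: u + x)]addrCA; congr (_ + _); rewrite addrAC.
move: lt1 lt2 => /=; rewrite {}E {E1 E2}.
move: ('D_v g2 (s1 *: u + _)) ('D_u g1 x) ('D_v g2 x) => z p q lt1 lt2.
rewrite -(subrK z p) -addrA (splitr e).
by rewrite (le_trans (ler_normD _ _)) // lerD // ltW // distrC.
Qed.

End Schwarz.

(** * Dual frames in finite dimension *)

Section Frame.
Context {R : realType} {V : normedModType R}.

(** Continuity of the coordinates is included because it lets them commute with derivatives. *)
Definition dual_frame (n : nat) (e : 'I_n -> V) (c : 'I_n -> {linear V ->
  R^o}) :=
  [/\ forall i, continuous (c i),
      forall v, v = \sum_i c i v *: e i
    & forall i j, c i (e j) = (i == j)%:R].

Definition spans (n : nat) (e : 'I_n -> V) :=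
  forall v, exists a : 'I_n -> R, v = \sum_i a i *: e i.

Lemma spans_drop n (e : 'I_n.+1 -> V) (a : 'I_n.+1 -> R) i :
  spans e -> a i != 0 -> \sum_j a j *: e j = 0 ->
  spans (fun j => e (lift i j)).
Proof.
move=> es ai0; rewrite (bigD1_ord i) //= => /eqP; rewrite addr_eq0 => /eqP E v.
have [b ->] := es v.
exists (fun j => b (lift i j) - b i / a i * a (lift i j)).
rewrite (bigD1_ord i) //= -[e i]scale1r -(mulVf ai0) -[(_ * _) *: e i]scalerA E.
rewrite scalerA scalerN scaler_sumr -sumrN -big_split /=.
by apply: eq_bigr => j _; rewrite scalerBl addrC scalerA.
Qed.

(** A spanning family of least size is free: a nontrivial relation would allow one vector to be
    dropped. *)
Lemma finite_dim_basis : finite_dim V -> exists (n : nat) (e : 'I_n -> V),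
  spans e /\ forall a : 'I_n -> R, \sum_i a i *: e i = 0 -> forall i, a i = 0.
Proof.
move=> fd.
have fd' : exists n, `[< exists e : 'I_n -> V, spans e >].
  by have [n [e es]] := fd; exists n; apply/asboolP; exists e.
have [n /asboolP[e es] nmin] := ex_minnP fd'; exists n, e; split=> // a a0 i.
apply/eqP/negPn/negP => ai0.
case: n e es a a0 i ai0 nmin => [|n] e es a a0 i ai0 nmin; first by case: i ai0.
have /nmin : `[< exists e : 'I_n -> V, spans e >].
  by apply/asboolP; exists (fun j => e (lift i j)); exact: spans_drop a0.
by rewrite ltnn.
Qed.

Definition comb (n : nat) (e : 'I_n -> V) (x : 'rV[R]_n) : V :=
  \sum_i x 0 i *: e i.

Lemma comb_linear n (e : 'I_n -> V) : linear (comb e).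
Proof.
move=> a x y; rewrite /comb scaler_sumr -big_split; apply: eq_bigr => i _ /=.
by rewrite !mxE scalerDl scalerA.
Qed.

HB.instance Definition _ n (e : 'I_n -> V) :=
  GRing.isLinear.Build _ _ _ _ (comb e) (comb_linear e).

Lemma comb_continuous n (e : 'I_n -> V) : continuous (comb e).
Proof.
move=> x; apply: (@cvg_big _ _ _ _ _ _ _ (nbhs x)) => [|i _];
  first exact: add_continuous.
apply: cvgZr_tmp.
exact: coord_continuous.
Qed.

(* The minimum of [|comb e x|] over the compact unit sphere of R^n is positive. *)
Lemma comb_bounded_below n (e : 'I_n -> V) :
  (forall x, comb e x = 0 -> x = 0) ->
  exists2 K : R, 0 < K & forall x, `|x| <= K * `|comb e x|.
Proof.
move=> inj.
pose S := [set x : 'rV[R]_n | `|x| = 1].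
have [[x0 Sx0]|S0] := pselect (S !=set0); last first.
  exists 1 => // x; have [->|x0] := eqVneq x 0; first by rewrite normr0 mul1r.
  by exfalso; apply: S0; exists (`|x|^-1 *: x); rewrite /S /= normfZV.
have cS : compact S.
  apply: bounded_closed_compact.
    by exists 1; split=> // y y1 x; rewrite /S /= => ->; exact: ltW.
  have -> : S = (fun x : 'rV[R]_n => `|x|) @^-1` [set 1] by [].
  by apply: closed_comp; [move=> x _; exact: norm_continuous|exact: closed_eq].
have [||c cS' cmin] := @EVT_min_rV R n (fun x => `|comb e x|) S _ cS.
- by exists x0.
- apply: continuous_subspaceT => x; apply: continuous_comp;
  last exact: norm_continuous.
  exact: comb_continuous.
have m0 : 0 < `|comb e c|.
  rewrite normr_gt0; apply/eqP => /inj c0; move: cS'; rewrite inE /S /=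
    c0 normr0 => /eqP.
  by rewrite eq_sym oner_eq0.
exists (`|comb e c|^-1); first by rewrite invr_gt0.
move=> x; have [->|x0'] := eqVneq x 0; first
  by rewrite normr0 mulr_ge0 // invr_ge0.
rewrite mulrC ler_pdivlMr // mulrC -ler_pdivlMr ?normr_gt0 //.
have := cmin (`|x|^-1 *: x); rewrite inE /S /= normfZV // linearZ /= normrZ.
by rewrite normfV normr_id mulrC => ->.
Qed.

(** The lower bound for [comb] gives |c_i(v)| <= K |v|, which is the continuity of the
    coordinates. *)
Lemma dual_frame_exists : finite_dim V -> exists n e c, @dual_frame n e c.
Proof.
move=> /finite_dim_basis[n [e [es efree]]].
have inj x : comb e x = 0 -> x = 0.
  by move=> x0; apply/rowP => i; rewrite mxE; exact: (efree (fun i => x 0 i)).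
have [K K0 Kle] := comb_bounded_below inj.
have surj v : exists x, v = comb e x.
  have [a ->] := es v; exists (\row_i a i); rewrite /comb.
  by apply: eq_bigr => i _; rewrite mxE.
pose x v := projT1 (cid (surj v)).
have xE v : v = comb e (x v) by rewrite /x; case: cid.
have xK y : x (comb e y) = y.
  by apply/eqP; rewrite -subr_eq0; apply/eqP/inj; rewrite linearB /= -xE subrr.
pose c i (v : V) : R^o := x v 0 i.
have clin i : linear (c i).
  move=> a u v; rewrite /c; have -> : x (a *: u + v) = a *: x u + x v.
    by rewrite -[RHS]xK linearP /= -!xE.
  by rewrite !mxE.
pose cL i : {linear V -> R^o} :=
  HB.pack (c i) (GRing.isLinear.Build _ _ _ _ (c i) (clin i)).
exists n, e, cL; split.
- move=> i; apply/linear_bounded_continuous/linear_boundedP.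
  near=> r => v; rewrite (@le_trans _ _ (K * `|v|)) //.
    rewrite [in leRHS](xE v) (le_trans _ (Kle _)) //= /c.
    rewrite [leRHS]/Num.norm /= mx_normrE.
    exact: (le_bigmax _ (fun ij : 'I_1 * 'I_n => `|x v ij.1 ij.2|) (0, i)).
  by rewrite ler_wpM2r //; near: r; apply: nbhs_pinfty_ge; exact: gtr0_real.
- by move=> v; rewrite {1}(xE v).
- move=> i j /=; rewrite /c.
  have -> : e j = comb e (delta_mx 0 j).
    rewrite /comb (bigD1 j) //= big1 ?addr0 => [|k kj]; rewrite mxE eqxx /=.
      by rewrite eqxx scale1r.
    by rewrite (negbTE kj) scale0r.
  by rewrite xK mxE eqxx.
Unshelve. all: by end_near. Qed.

End Frame.

Section LinearFunctions.
Context {R : realType} {V : lmodType R}.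

Lemma linear_fun0 (W : lmodType R) (f : V -> W) : linear f -> f 0 = 0.
Proof. by move=> lf; have := lf (-1) 0 0;
  rewrite scaler0 addr0 scaleN1r addNr. Qed.

Lemma linear_funD (W : lmodType R) (f : V -> W) u v : linear f -> f (u + v) =
  f u + f v.
Proof. by move=> lf; have := lf 1 u v; rewrite !scale1r. Qed.

Lemma linear_funZ (W : lmodType R) (f : V -> W) a u : linear f -> f (a *: u) =
  a *: f u.
Proof. by move=> lf; have := lf a u 0;
  rewrite !addr0 (linear_fun0 lf) addr0. Qed.

Lemma linear_funB (W : lmodType R) (f : V -> W) u v : linear f -> f (u - v) =
  f u - f v.
Proof. by move=> lf; rewrite addrC -[- v]scaleN1r lf scaleN1r addrC. Qed.

Lemma linear_sum_fun (W : lmodType R) (f : V -> W) (I : Type) (r : seq I)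
    (a : I -> R) (u : I -> V) : linear f ->
  f (\sum_(i <- r) a i *: u i) = \sum_(i <- r) a i *: f (u i).
Proof.
move=> lf; elim: r => [|i r IH]; first by rewrite !big_nil (linear_fun0 lf).
by rewrite !big_cons lf IH.
Qed.

End LinearFunctions.

(** * Coordinates of fields and smooth families of linear maps *)

Section SmoothFields.
Context {R : realType} {V : normedModType R}.
Implicit Types (U : set V).

Lemma derive_linear_comp (W W' : normedModType R) (L : {linear W -> W'})
    (f : V -> W) x v : continuous L -> differentiable f x ->
  'D_v (fun y => L (f y)) x = L ('D_v f x).
Proof.
move=> cL df; have dL : differentiable L (f x) by exact: linear_differentiable.
by rewrite !deriveE //; [rewrite diff_comp // diff_lin|exact:
  differentiable_comp].
Qed.

Lemma smooth_on_linear_comp (W W' : normedModType R) (L : {linear W -> W'}) U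
    (f : V -> W) : open U -> continuous L -> smooth_on U f ->
  smooth_on U (fun x => L (f x)).
Proof.
move=> oU cL /smooth_onP sf; apply/smooth_onP => n.
elim: n f {sf} (sf n) => [|n IH] f [df Df]; split=> //.
- move=> x Ux; apply: differentiable_comp; first exact: df.
  exact: linear_differentiable.
- move=> x Ux; apply: differentiable_comp; first exact: df.
  exact: linear_differentiable.
- move=> v; apply: differentiable_upto_eq (IH _ (Df v)) => // x Ux.
  by rewrite derive_linear_comp //; exact: df.
Qed.

Lemma smooth_on_id U : smooth_on U (id : V -> V).
Proof.
apply/smooth_onP; case=> [|n]; split=> // v; rewrite (_ : (fun x => _) = cst v).
  by have /smooth_onP := smooth_on_cst (U := U) v; exact.
by apply/funext => x; rewrite derive_id.
Qed.

Lemma smooth_onN (W : normedModType R) U (f : V -> W) : open U ->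
  smooth_on U f ->
  smooth_on U (fun x => - f x).
Proof.
move=> oU sf; apply: (smooth_on_eq oU _ (smooth_on_scale oU (smooth_on_cst (-1
  : R^o)) sf)).
by move=> x _; rewrite scaleN1r.
Qed.

Lemma smooth_onB (W : normedModType R) U (f g : V -> W) : open U ->
  smooth_on U f -> smooth_on U g -> smooth_on U (fun x => f x - g x).
Proof. by move=> oU sf sg; apply: smooth_onD => //; exact: smooth_onN. Qed.

Section WithFrame.
Context {n : nat} {e : 'I_n -> V} {c : 'I_n -> {linear V -> R^o}}.
Context (fr : dual_frame e c) {U : set V} (oU : open U).

Lemma smooth_on_coord (B : V -> V) i : smooth_on U B ->
  smooth_on (W := R^o) U (fun x => c i (B x)).
Proof. by move=> sB; apply: smooth_on_linear_comp => //; case: fr. Qed.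

Lemma derive_coord (B : V -> V) i x v : smooth_on U B -> U x ->
  'D_v (fun y => c i (B y)) x = c i ('D_v B x).
Proof.
move=> sB Ux; rewrite derive_linear_comp //; first by case: fr.
exact: smooth_on_diff sB Ux.
Qed.

Lemma frame_ext (u v : V) : (forall i, c i u = c i v) -> u = v.
Proof.
have [_ cE _] := fr => uv.
have E := cE u; have E' := cE v; apply: etrans E (etrans _ (esym E')).
by apply: eq_bigr => i _; rewrite uv.
Qed.

Lemma derive2_coord (B : V -> V) u v x i : smooth_on U B -> U x ->
  c i ('D_u (fun y => 'D_v B y) x) =
  'D_u (fun y => 'D_v (fun z => c i (B z)) y) x.
Proof.
move=> sB Ux; apply: etrans (esym (derive_coord i u (smooth_on_derive v sB)
  Ux)) _.
by apply: (derive_eq_on u oU _ Ux) => y Uy; rewrite -(derive_coord i v sB Uy).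
Qed.

Lemma derive_comm (B : V -> V) u v x : smooth_on U B -> U x ->
  'D_u (fun y => 'D_v B y) x = 'D_v (fun y => 'D_u B y) x.
Proof.
move=> sB Ux; apply: frame_ext => i.
apply: etrans (derive2_coord u v i sB Ux) (etrans _ (esym (derive2_coord v u i
  sB Ux))).
exact: (derive_comm_real u v oU (smooth_on_coord i sB) Ux).
Qed.

(** Covers at once [Gamma] with one argument filled and the differential of a smooth map. Smoothness
    is asked for fixed [u] only; expansion in the frame recovers it for a varying argument. *)
Definition smooth_linear_field (W : normedModType R) (M : V -> V -> W) :=
  (forall x, U x -> linear (M x)) /\ forall u, smooth_on U (fun x => M x u).

Section LinearField.
Context {W : normedModType R} (M : V -> V -> W) (sM : smooth_linear_field M).
Context (B : V -> V) (sB : smooth_on U B).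

Lemma linear_field_coord x u : U x -> M x u = \sum_i c i u *: M x (e i).
Proof.
move=> Ux; have [_ cE _] := fr; rewrite {1}(cE u).
by rewrite linear_sum_fun //; exact: sM.1.
Qed.

Lemma smooth_linear_field_app : smooth_on U (fun x => M x (B x)).
Proof.
apply: (smooth_on_eq oU) => [x Ux|]; first by symmetry;
  exact: linear_field_coord.
apply: smooth_on_sum => // i; apply: smooth_on_scale => //; last exact: sM.2.
exact: smooth_on_coord.
Qed.

(** Expanding the argument in the frame reduces this to the product rule for a scalar times a
    vector; the sum with frozen coefficients [c i (B x)] is the first term on the right. *)
Lemma derive_linear_field x v : U x ->
  'D_v (fun y => M y (B y)) x = 'D_v (fun y => M y (B x)) x + M x ('D_v B x).
Proof.
move=> Ux.
have dM y i : U y -> differentiable (fun z => M z (e i)) y.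
  by move=> Uy; exact: smooth_on_diff (sM.2 _) Uy.
have dc i : differentiable (fun z => c i (B z) : R^o) x.
  exact: smooth_on_diff (smooth_on_coord _ sB) Ux.
have dsum (a : 'I_n -> V -> R) : (forall i, differentiable (a i : V ->
  R^o) x) ->
    'D_v (fun y => \sum_i a i y *: M y (e i)) x =
    \sum_i ('D_v (a i : V -> R^o) x *: M x (e i) + a i x *: 'D_v (fun y =>
      M y (e i)) x).
  move=> da; rewrite (_ : (fun y => _) = \sum_i (fun y => a i y *: M y (e i))).
    rewrite derive_sum => [|i]; last first.
      by apply: diff_derivable; apply: differentiable_scale => //; exact: dM.
    by apply: eq_bigr => i _; rewrite derive_scale //; exact: dM.
  by apply/funext => y; rewrite fct_sumE.
rewrite (@derive_eq_on _ _ _ U _ (fun y => \sum_i c i (B y) *: M y (e i))) //;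
  last first.
  by move=> y Uy; exact: linear_field_coord.
rewrite [in RHS](@derive_eq_on _ _ _ U _ (fun y =>
  \sum_i c i (B x) *: M y (e i))) //; last first.
  by move=> y Uy; exact: linear_field_coord.
rewrite (dsum (fun i y => c i (B y))) //.
rewrite (dsum (fun i y => c i (B x))) //.
rewrite (linear_field_coord _ Ux) -big_split; apply: eq_bigr => i _ /=.
by rewrite derive_cst scale0r add0r derive_coord // addrC.
Qed.

End LinearField.

Lemma smooth_linear_derive (W : normedModType R) (f : V -> W) : smooth_on U f ->
  smooth_linear_field (fun x u => 'D_u f x).
Proof.
move=> sf; split=> [x Ux a u v|u]; last exact: smooth_on_derive.
by rewrite !deriveE ?linearP //; exact: smooth_on_diff sf Ux.
Qed.

End WithFrame.
End SmoothFields.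

(** * Covariant derivatives of fields *)

(** Bookkeeping for the curvature: [p] is the second derivative of C, the same in both orders; [k]
    and [m] are the cross terms Gamma(B, D_A C) and Gamma(A, D_B C); the [q] and [h] terms contain
    D_A B or D_B A and are absorbed by the bracket. *)
Lemma curvature_cancel (M : zmodType) (p q1 q2 g1 g2 h1 h2 k m r1 r2 : M) :
  p + q1 + (g1 + h1 + k) + (m + r1) - (p + q2 + (g2 + h2 + m) + (k + r2))
  - (q1 - q2 + (h1 - h2)) = g1 - g2 + r1 - r2.
Proof.
rewrite -[q1](subrK q2) -[g1](subrK g2) -[h1](subrK h2) -[r1](subrK r2) !addrK.
move: (q1 - q2) (g1 - g2) (h1 - h2) (r1 - r2) => q g h r.
rewrite [in RHS]addrA addrK; apply/eqP; rewrite !subr_eq; apply/eqP.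
by rewrite !addrA [LHS](ACl (4*10*2*6*1*3*5*7*9*8*11)%AC).
Qed.

Section Connection.
Context {R : realType} {V : normedModType R}.
Context {n : nat} {e : 'I_n -> V} {c : 'I_n -> {linear V -> R^o}}.
Context (fr : dual_frame e c) {U : set V} (oU : open U).
Context {Gamma : V -> V -> V -> V} (conn : connection U Gamma).
Implicit Types (A B C D : V -> V).

Lemma Gamma_linear_r x u : U x -> linear (Gamma x u).
Proof. by move=> Ux; exact: (connection_bilinear conn Ux).1. Qed.

Lemma Gamma_linear_l x v : U x -> linear (Gamma x ^~ v).
Proof. by move=> Ux; exact: (connection_bilinear conn Ux).2. Qed.

Lemma smooth_linear_Gamma_l v : smooth_linear_field (U := U) (fun x u =>
  Gamma x u v).
Proof.
by split=> [x Ux|u]; [exact: Gamma_linear_l | exact: connection_smooth conn _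
  _].
Qed.

Lemma smooth_linear_Gamma_r A : smooth_on U A ->
  smooth_linear_field (U := U) (fun x u => Gamma x (A x) u).
Proof.
move=> sA; split=> [x Ux|v]; first exact: Gamma_linear_r.
exact: (smooth_linear_field_app fr oU (smooth_linear_Gamma_l v)).
Qed.

Lemma smooth_Gamma A B : smooth_on U A -> smooth_on U B ->
  smooth_on U (fun x => Gamma x (A x) (B x)).
Proof.
by move=> sA sB; exact: (smooth_linear_field_app fr oU (smooth_linear_Gamma_r
  sA)).
Qed.

Lemma derive_Gamma A B x v : smooth_on U A -> smooth_on U B -> U x ->
  'D_v (fun y => Gamma y (A y) (B y)) x =
  'D_v (fun y => Gamma y (A x) (B x)) x
  + Gamma x ('D_v A x) (B x) + Gamma x (A x) ('D_v B x).
Proof.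
move=> sA sB Ux.
rewrite (derive_linear_field fr oU (smooth_linear_Gamma_r sA)) //.
by rewrite (derive_linear_field fr oU (smooth_linear_Gamma_l (B x))).
Qed.

Lemma smooth_derive_along A B : smooth_on U A -> smooth_on U B ->
  smooth_on U (fun x => 'D_(A x) B x).
Proof.
by move=> sA sB; exact: (smooth_linear_field_app fr oU (smooth_linear_derive
  sB)).
Qed.

Lemma derive_derive_along A B x v : smooth_on U A -> smooth_on U B -> U x ->
  'D_v (fun y => 'D_(A y) B y) x =
  'D_v (fun y => 'D_(A x) B y) x + 'D_('D_v A x) B x.
Proof.
move=> sA sB Ux.
by rewrite (derive_linear_field fr oU (smooth_linear_derive sB)).
Qed.

Lemma smooth_nabla A B : smooth_on U A -> smooth_on U B ->
  smooth_on U (nabla Gamma A B).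
Proof.
move=> sA sB; apply: smooth_onD => //; first exact: smooth_derive_along.
exact: smooth_Gamma.
Qed.

Lemma smooth_lie_bracket A B : smooth_on U A -> smooth_on U B ->
  smooth_on U (lie_bracket A B).
Proof. by move=> sA sB; apply: smooth_onB => //;
  exact: smooth_derive_along. Qed.

Lemma derive_nabla A B x v : smooth_on U A -> smooth_on U B -> U x ->
  'D_v (nabla Gamma A B) x =
  'D_v (fun y => 'D_(A x) B y) x + 'D_('D_v A x) B x
  + ('D_v (fun y => Gamma y (A x) (B x)) x
     + Gamma x ('D_v A x) (B x) + Gamma x (A x) ('D_v B x)).
Proof.
move=> sA sB Ux; rewrite -derive_derive_along // -derive_Gamma //.
rewrite /nabla; apply: deriveD; apply: diff_derivable.
- exact: (smooth_on_diff (smooth_derive_along sA sB)).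
- exact: (smooth_on_diff (smooth_Gamma sA sB)).
Qed.

Lemma nablaE A B x : nabla Gamma A B x = 'D_(A x) B x + Gamma x (A x) (B x).
Proof. by []. Qed.

Lemma nabla_nabla A B C x : smooth_on U A -> smooth_on U B -> smooth_on U C ->
  U x ->
  nabla Gamma A (nabla Gamma B C) x =
  'D_(A x) (fun y => 'D_(B x) C y) x + 'D_('D_(A x) B x) C x
  + ('D_(A x) (fun y => Gamma y (B x) (C x)) x
     + Gamma x ('D_(A x) B x) (C x) + Gamma x (B x) ('D_(A x) C x))
  + (Gamma x (A x) ('D_(B x) C x) + Gamma x (A x) (Gamma x (B x) (C x))).
Proof.
move=> sA sB sC Ux; rewrite nablaE derive_nabla //.
by rewrite nablaE (linear_funD _ _ (Gamma_linear_r (A x) Ux)).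
Qed.

(** The classical expression of the curvature by the connection form and its first derivatives, a
    function of vectors at a single point. *)
Definition riemann (x b c d : V) : V :=
  'D_b (fun y => Gamma y c d) x - 'D_c (fun y => Gamma y b d) x
  + Gamma x b (Gamma x c d) - Gamma x c (Gamma x b d).

(** Tensoriality of the curvature: second derivatives of [C] cancel by symmetry, derivatives of [A]
    and [B] against the bracket term. *)
Lemma curvatureE A B C x : smooth_on U A -> smooth_on U B -> smooth_on U C ->
  U x ->
  curvature Gamma A B C x = riemann x (A x) (B x) (C x).
Proof.
move=> sA sB sC Ux.
have subE (T1 T2 T3 : V -> V) : (T1 - T2 - T3) x = T1 x - T2 x - T3 x by [].
have dl := (smooth_linear_derive sC).1 _ Ux.
rewrite /curvature subE !nabla_nabla // (nablaE (lie_bracket A B)) /lie_bracket.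
rewrite (linear_funB _ _ dl) (linear_funB _ _ (Gamma_linear_l (C x) Ux)).
rewrite (derive_comm fr oU _ _ sC Ux) /riemann; exact: curvature_cancel.
Qed.
End Connection.

Arguments riemann {R V} Gamma x b c d.

(** * Iterated covariant derivatives along a line *)

Lemma derive_lineE (R : realType) (V W : normedModType R) (f : V ->
  W) (u y : V) (t : R) :
  'D_u f (t *: u + y) = 'D_1 (fun s : R => f (s *: u + y)) t.
Proof.
rewrite /derive (_ : (fun h => _) = fun h => h^-1 *: (((fun s : R =>
  f (s *: u + y))
  \o shift t) (h *: 1) - f (t *: u + y))) //; apply/funext => h /=.
by rewrite [_%:A]mulr1 scalerDl addrA.
Qed.

Section Line.
Context {R : realType} {V : normedModType R}.
Context {n : nat} {e : 'I_n -> V} {c : 'I_n -> {linear V -> R^o}}.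
Context (fr : dual_frame e c) {U : set V} (oU : open U).
Context {Gamma : V -> V -> V -> V} (conn : connection U Gamma) (X : V).
Implicit Types (A B C D : V -> V) (p : V).

Definition on_line p := U p /\ exists t : R, p = t *: X.

(** The derivative in the direction [X] sees only the restriction to the line, so identities known
    on the line alone may be differentiated along it. *)
Lemma derive_on_line (W : normedModType R) (f g : V -> W) p :
  (forall q, on_line q -> f q = g q) -> on_line p -> 'D_X f p = 'D_X g p.
Proof.
move=> fg [Up [t pE]].
have -> : p = 0 *: X + p by rewrite scale0r add0r.
rewrite !derive_lineE; apply: near_eq_derive.
have : \forall s \near (0 : R), U (s *: X + p).
  have cp : (fun s : R => s *: X + p) s @[s --> (0 : R)] --> 0 *: X + p.
    by apply: cvgD; [exact: scalel_continuous | exact: cvg_cst].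
  apply: cp; rewrite scale0r add0r; exact: open_nbhs_nbhs.
apply: filterS => s Us; apply: fg; split=> //.
by exists (s + t); rewrite scalerDl -pE.
Qed.

(** nabla_X X vanishes on the line but in general not off it. Recording only the restriction to the
    line gives a class of fields, null or radial, inside which [nabla] always produces a null
    field. *)
Definition null_field A := smooth_on U A /\ forall p, on_line p -> A p = 0.
Definition radial_field A := smooth_on U A /\ forall p, on_line p -> A p = X.
Definition null_or_radial A := null_field A \/ radial_field A.

Context (GXX : forall p, on_line p -> Gamma p X X = 0).

Lemma null_or_radial_smooth A : null_or_radial A -> smooth_on U A.
Proof. by case=> -[]. Qed.

Lemma radial_cst : radial_field (cst X).
Proof. by split=> //; exact: smooth_on_cst. Qed.

Lemma nabla_null_l A B p : null_field A -> on_line p -> nabla Gamma A B p = 0.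
Proof.
move=> [_ A0] pL; rewrite nablaE A0 // derive0 add0r.
exact: linear_fun0 (Gamma_linear_l conn _ pL.1).
Qed.

Lemma nabla_radialE A B p : radial_field A -> on_line p ->
  nabla Gamma A B p = 'D_X B p + Gamma p X (B p).
Proof. by move=> [_ AX] pL; rewrite nablaE AX. Qed.

Lemma nabla_radial_eq A B C p : radial_field A ->
  (forall q, on_line q -> B q = C q) -> on_line p ->
  nabla Gamma A B p = nabla Gamma A C p.
Proof.
by move=> rA BC pL; rewrite !nabla_radialE // BC // (derive_on_line BC).
Qed.

Lemma nabla_radial0 A B p : radial_field A ->
  (forall q, on_line q -> B q = 0) -> on_line p -> nabla Gamma A B p = 0.
Proof.
move=> rA B0 pL; rewrite nabla_radialE // (@derive_on_line _ B (cst 0)) //.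
by rewrite derive_cst B0 // add0r (linear_fun0 (Gamma_linear_r conn _ pL.1)).
Qed.

Lemma nabla_null A B : null_or_radial A -> null_or_radial B ->
  null_field (nabla Gamma A B).
Proof.
move=> nA nB; split.
  by apply: (smooth_nabla fr oU conn); exact: null_or_radial_smooth.
move=> p pL; case: nA => [nA|rA]; first exact: nabla_null_l.
case: nB => [[_ B0]|[_ BX]]; first exact: nabla_radial0.
rewrite nabla_radialE // (@derive_on_line _ B (cst X)) //.
by rewrite derive_cst BX // add0r GXX.
Qed.

Lemma nabla_null_or_radial A B : null_or_radial A -> null_or_radial B ->
  null_or_radial (nabla Gamma A B).
Proof. by move=> ? ?; left; exact: nabla_null. Qed.

(* [Q] is a class of sections to which the argument applies, and [Z] says that
   a section vanishes on the line through [X].  Working on that line only, the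
   correction terms of the iterated covariant derivative drop out without any
   appeal to its tensoriality in the directions of differentiation. *)
Section IterNabla.
Context (S : zmodType) (D : (V -> V) -> S -> S) (Q Z : S -> Prop) (psi : S).
Context (Q0 : Q 0) (QB : forall s t, Q s -> Q t -> Q (s - t)).
Context (Z0 : Z 0) (ZB : forall s t, Z s -> Z t -> Z (s - t)).
Context (QD : forall A s, null_or_radial A -> Q s -> Q (D A s)).
Context (DZ : forall A s, radial_field A -> Q s -> Z s -> Z (D A s)).
Context (DN : forall A s, null_field A -> Q s -> Z (D A s)).
Context (Qpsi : Q psi).

Lemma subr_closed_sum (P : S -> Prop) (I : Type) (r : seq I) (f : I -> S) :
  P 0 -> (forall s t, P s -> P t -> P (s - t)) -> (forall i, P (f i)) ->
  P (\sum_(i <- r) f i).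
Proof.
move=> P0 PB Pf; elim: r => [|i r IH]; first by rewrite big_nil.
by rewrite big_cons -[\sum_(_ <- _) _]opprK; apply: (PB _ _ (Pf i));
  rewrite -sub0r; exact: PB.
Qed.

Lemma iter_nabla_good k (A : 'I_k -> V -> V) :
  (forall i, null_or_radial (A i)) -> Q (iter_nabla Gamma D psi A).
Proof.
elim: k A => [|k IH] A nA //=.
apply: QB; first by apply: QD => //; exact: IH.
apply: subr_closed_sum => // i; apply: IH => j; case: ifP => // _.
exact: nabla_null_or_radial.
Qed.

(** If the null direction comes first, [DN] applies; if it comes later and the first one is radial,
    the induction hypothesis is differentiated by [DZ]. Each correction term contains a new null
    direction, a value of [nabla]. *)
Lemma iter_nabla_null k (A : 'I_k -> V -> V) :
  (forall i, null_or_radial (A i)) -> (exists i, null_field (A i)) ->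
  Z (iter_nabla Gamma D psi A).
Proof.
elim: k A => [|k IH] A nA [i0 ni0]; first by case: i0 ni0.
rewrite /=; apply: ZB.
  have Qi : Q (iter_nabla Gamma D psi (fun i => A (lift ord0 i))).
    by apply: iter_nabla_good => i.
  have [n0|r0] := nA ord0; first exact: DN.
  have [j ji|j0] := unliftP ord0 i0; last by apply: DN => //; rewrite -j0.
  apply: DZ => //; apply: IH => //; exists j; by rewrite -ji.
apply: subr_closed_sum => // i; apply: IH => [j|]; first case: ifP => // _.
  exact: nabla_null_or_radial.
by exists i; rewrite eqxx; exact: nabla_null.
Qed.

Lemma iter_nabla_radial k :
  Z (iter_nabla Gamma D psi (k := k.+1) (fun=> cst X)
     - D (cst X) (iter_nabla Gamma D psi (k := k) (fun=> cst X))).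
Proof.
rewrite /= addrAC subrr; apply: ZB => //; apply: subr_closed_sum => // i.
have rX := or_intror radial_cst : null_or_radial (cst X).
apply: iter_nabla_null => [j|]; first case: ifP => // _.
  exact: nabla_null_or_radial.
by exists i; rewrite eqxx; exact: nabla_null.
Qed.

End IterNabla.
End Line.

(** * Iterated derivatives of vector fields and of tensors on the line *)

Section AlongLine.
Context {R : realType} {V : normedModType R}.
Context {n : nat} {e : 'I_n -> V} {c : 'I_n -> {linear V -> R^o}}.
Context (fr : dual_frame e c) {U : set V} (oU : open U).
Context {Gamma : V -> V -> V -> V} (conn : connection U Gamma) (X : V).
Context (GXX : forall p, on_line (U := U) X p -> Gamma p X X = 0).
Implicit Types (A B C E : V -> V) (p : V).

Notation onL := (on_line (U := U) X).
Notation nr := (null_or_radial (U := U) X).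
Notation nullf := (null_field (U := U) X).
Notation N := (nabla Gamma (cst X)).
Notation tensor := ((V -> V) -> (V -> V) -> (V -> V) -> V -> V).

Lemma derive_sum_scale (I : finType) (a : I -> V -> R) (f : I -> V -> V) p v :
  (forall i, differentiable (a i : V -> R^o) p) ->
  (forall i, differentiable (f i) p) ->
  'D_v (fun q => \sum_i a i q *: f i q) p =
  \sum_i ('D_v (a i : V -> R^o) p *: f i p + a i p *: 'D_v (f i) p).
Proof.
move=> da df.
have H : forall r : seq I, is_derive p v (fun q => \sum_(i <- r) a i q *: f i q)
    (\sum_(i <- r) ('D_v (a i : V -> R^o) p *: f i p + a i p *: 'D_v (f i) p)).
  elim=> [|i r IH].
    rewrite big_nil (_ : (fun q => _) = cst 0); first exact: is_derive_cst.
    by apply/funext => q; rewrite big_nil.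
  rewrite big_cons (_ : (fun q => _) = (fun q => a i q *: f i q) +
    (fun q => \sum_(j <- r) a j q *: f j q)).
    apply: is_deriveD; apply: is_derive_scale; apply: derivableP;
      exact: diff_derivable.
  by apply/funext => q; rewrite big_cons.
exact: (@derive_val _ _ _ _ _ _ _ (H _)).
Qed.

Lemma nabla_sum (I : finType) A (a : I -> V -> R) (f : I -> V -> V) p :
  (forall i, differentiable (a i : V -> R^o) p) ->
  (forall i, differentiable (f i) p) ->
  U p ->
  nabla Gamma A (fun q => \sum_i a i q *: f i q) p =
  \sum_i ('D_(A p) (a i : V -> R^o) p *: f i p +
    a i p *: nabla Gamma A (f i) p).
Proof.
move=> da df Up; rewrite nablaE derive_sum_scale //.
rewrite (linear_sum_fun _ _ _ (Gamma_linear_r conn (A p) Up)) -big_split.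
by apply: eq_bigr => i _ /=; rewrite nablaE scalerDr addrA.
Qed.

Let rX : radial_field (U := U) X (cst X) := radial_cst X.
Let nrX : nr (cst X) := or_intror rX.

Lemma smooth_iter_nabla_cst k B : smooth_on U B -> smooth_on U (iter k N B).
Proof.
move=> sB; elim: k => //= k IH; apply: (smooth_nabla fr oU conn) => //.
exact: smooth_on_cst.
Qed.

(** The preceding argument with [Q] the smooth fields and [Z] the fields vanishing on the line;
    [nabla_radial_eq] allows the induction hypothesis to be differentiated. *)
Lemma iter_nabla_section k Y p : onL p ->
  iter_nabla Gamma (nabla Gamma) (cst Y) (k := k) (fun=> cst X) p =
  iter k N (cst Y) p.
Proof.
elim: k p => [//|k IH] p pL.
have := @iter_nabla_radial R V n e c fr U oU Gamma conn X GXX _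
  (nabla Gamma) (smooth_on U) (fun s => forall q, onL q -> s q = 0) (cst Y)
  (smooth_on_cst 0) (fun s t => smooth_onB oU) (fun q _ => erefl).
move=> H; have : (iter_nabla Gamma (nabla Gamma) (cst Y) (k :=
  k.+1) (fun=> cst X)
     - N (iter_nabla Gamma (nabla Gamma) (cst Y) (k := k) (fun=> cst X))) p = 0.
  apply: H => //.
  - by move=> s t s0 t0 q qL; rewrite -[LHS]/(s q - t q) s0 // t0 // subrr.
  - by move=> A s nA sA; apply: (smooth_nabla fr oU conn) => //;
    exact: null_or_radial_smooth nA.
  - by move=> A s rA _ s0 q qL; exact: (nabla_radial0 oU conn rA).
  - by move=> A s nA _ q qL; exact: (nabla_null_l conn _ nA).
  - exact: smooth_on_cst.
move=> /eqP; rewrite subr_eq0 => /eqP ->.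
exact: (nabla_radial_eq oU rX).
Qed.

(** A weak tensoriality on the line that survives covariant differentiation. The first slot receives
    arbitrary fields such as N^j Y, so pointwise linearity is required there; the other two only
    ever receive X or fields such as nabla_X X, so vanishing on null fields is enough. *)
Definition good_tensor (T : tensor) := [/\
  forall B C E, smooth_on U B -> smooth_on U C -> smooth_on U E ->
    smooth_on U (T B C E),
  forall B C E p, smooth_on U B -> nr C -> nr E -> onL p ->
    T B C E p = \sum_i c i (B p) *: T (cst (e i)) C E p
& forall B C E p, smooth_on U B -> nr C -> nr E -> nullf C \/ nullf E ->
  onL p ->
    T B C E p = 0].

Definition null_tensor (T : tensor) :=
  forall B C E p, smooth_on U B -> nr C -> nr E -> onL p -> T B C E p = 0.

Lemma good_tensorB (S T : tensor) : good_tensor S -> good_tensor T ->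
  good_tensor (S - T).
Proof.
move=> [S1 S2 S3] [T1 T2 T3].
have subE A B C p : (S - T) A B C p = S A B C p - T A B C p by [].
split=> [B C E sB sC sE|B C E p sB nC nE pL|B C E p sB nC nE CE pL].
- by apply: smooth_onB => //; [exact: S1|exact: T1].
- by rewrite subE S2 // T2 // -sumrB; apply: eq_bigr => i _;
  rewrite subE scalerBr.
- by rewrite subE S3 // T3 // subrr.
Qed.

Lemma nabla13E A (T : tensor) B C E p : nabla13 Gamma A T B C E p =
  nabla Gamma A (T B C E) p - T (nabla Gamma A B) C E p
  - T B (nabla Gamma A C) E p - T B C (nabla Gamma A E) p.
Proof. by []. Qed.

Lemma good_tensor_nabla A T : nr A -> good_tensor T ->
  good_tensor (nabla13 Gamma A T).
Proof.
move=> nA [T1 T2 T3]; have sA := null_or_radial_smooth nA.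
have sN B : smooth_on U B -> smooth_on U (nabla Gamma A B).
  by move=> sB; exact: (smooth_nabla fr oU conn).
have nN B : nr B -> nullf (nabla Gamma A B)
  by exact: (nabla_null fr oU conn GXX).
have nrN B : nr B -> nr (nabla Gamma A B) by move=> ?; left; exact: nN.
have nrs B : nr B -> smooth_on U B by exact: null_or_radial_smooth.
have T3C B C E p : smooth_on U B -> nr C -> nr E -> onL p ->
    T B (nabla Gamma A C) E p = 0.
  by move=> sB nC nE pL; apply: T3 => //; [exact: nrN|left; exact: nN].
have T3E B C E p : smooth_on U B -> nr C -> nr E -> onL p ->
    T B C (nabla Gamma A E) p = 0.
  by move=> sB nC nE pL; apply: T3 => //; [exact: nrN|right; exact: nN].
have NE B C E p : smooth_on U B -> nr C -> nr E -> onL p ->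
  nabla13 Gamma A T B C E p =
    nabla Gamma A (T B C E) p - T (nabla Gamma A B) C E p.
  by move=> sB nC nE pL; rewrite nabla13E T3C // T3E // !subr0.
split=> [B C E sB sC sE|B C E p sB nC nE pL|B C E p sB nC nE CE pL].
- by apply: smooth_onB => //; [apply: smooth_onB => //; [apply: smooth_onB =>
  //|]|];
    auto.
- have sei i : smooth_on U (cst (e i)) by exact: smooth_on_cst.
  rewrite NE //; under eq_bigr => i _ do rewrite NE //.
  have ts i : smooth_on U (T (cst (e i)) C E) by auto.
  have T0 F : smooth_on U F -> F p = 0 -> T F C E p = 0.
    by move=> sF F0; rewrite T2 // big1 // => i _; rewrite F0 linear0 scale0r.
  case: nA => [nA|rA].
    rewrite (nabla_null_l conn _ nA) // T0 ?(nabla_null_l conn _ nA) ?subrr;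
      auto.
    rewrite big1 // => i _.
    by rewrite (nabla_null_l conn _ nA) // T0 ?(nabla_null_l conn _ nA) ?subrr
      ?scaler0; auto.
  have Up := pL.1.
  rewrite (@nabla_radial_eq _ _ _ oU Gamma X A _ (fun q =>
    \sum_i c i (B q) *: T (cst (e i)) C E q)) //; last by move=> q qL;
      exact: T2.
  rewrite nabla_sum //; first last.
  - by move=> i; exact: smooth_on_diff (ts i) Up.
  - by move=> i; exact: smooth_on_diff (smooth_on_coord fr oU i sB) Up.
  rewrite big_split /= addrC; under [in RHS]eq_bigr => i _ do rewrite scalerBr.
  rewrite sumrB -addrA; congr (_ + _).
  rewrite (T2 (nabla Gamma A B)); auto.
  (* The derivatives of the coordinates of [B] cancel between the two terms of [NE]. What remains,
     the coordinates of Gamma(A, B), is matched with the terms T(nabla_A e_i) by expanding [B p] in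
     the frame and exchanging sums. *)
  have cNE i : c i (nabla Gamma A B p) = 'D_(A p) (fun q => c i (B q)) p +
    c i (Gamma p (A p) (B p)).
    by rewrite (derive_coord fr i _ sB Up) -linearD.
  have -> : \sum_i c i (nabla Gamma A B p) *: T (cst (e i)) C E p =
      \sum_i 'D_(A p) (fun q => c i (B q)) p *: T (cst (e i)) C E p
      + \sum_i c i (Gamma p (A p) (B p)) *: T (cst (e i)) C E p.
    by rewrite -big_split; apply: eq_bigr => i _; rewrite cNE scalerDl.
  rewrite opprD addrA subrr sub0r; congr (- _).
  have TN i : T (nabla Gamma A (cst (e i))) C E p =
      \sum_j c j (Gamma p (A p) (e i)) *: T (cst (e j)) C E p.
    by rewrite T2; auto; apply: eq_bigr => j _; rewrite nablaE derive_cst add0r.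
  under [RHS]eq_bigr => i _ do rewrite TN scaler_sumr.
  rewrite exchange_big /=; apply: eq_bigr => j _.
  rewrite (linear_field_coord fr (smooth_linear_Gamma_r fr oU conn sA) (B p)
    Up).
  by rewrite linear_sum scaler_suml; apply: eq_bigr => i _;
    rewrite linearZ scalerA.
- rewrite NE // (T3 (nabla Gamma A B) C E) ?subr0; auto.
  case: nA => [nA|rA]; first exact: (nabla_null_l conn _ nA).
  by apply: (nabla_radial0 oU conn rA) => // q qL; exact: T3.
Qed.

End AlongLine.

Lemma sum_binS (R : realType) (M : lmodType R) (m : nat) (f : nat -> M) :
  \sum_(j < m.+2) 'C(m.+1, j)%:R *: f j =
  \sum_(j < m.+1) 'C(m, j)%:R *: f j
  + \sum_(j < m.+1) 'C(m, j)%:R *: f j.+1 :> M.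
Proof.
rewrite big_ord_recl [X in _ = X + _]big_ord_recl /= !bin0 -addrA; congr (_ +
  _).
under eq_bigr => i _ do rewrite /bump /= add1n binS natrD scalerDl.
rewrite big_split /=; congr (_ + _).
by rewrite big_ord_recr /= bin_small // scale0r addr0.
Qed.

(** * Iterated derivatives of the curvature on the line *)

Section Curvature.
Context {R : realType} {V : normedModType R}.
Context {n : nat} {e : 'I_n -> V} {c : 'I_n -> {linear V -> R^o}}.
Context (fr : dual_frame e c) {U : set V} (oU : open U).
Context {Gamma : V -> V -> V -> V} (conn : connection U Gamma) (X : V).
Context (GXX : forall p, on_line (U := U) X p -> Gamma p X X = 0).
Implicit Types (A B C E : V -> V) (p : V).

Notation onL := (on_line (U := U) X).
Notation nr := (null_or_radial (U := U) X).
Notation N := (nabla Gamma (cst X)).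

Lemma riemann_coord p b c' d : U p ->
  riemann Gamma p b c' d = \sum_i c i b *: riemann Gamma p (e i) c' d.
Proof.
move=> Up.
have sG u v : smooth_on U (fun y => Gamma y u v)
  by exact: connection_smooth conn u v.
have bE : b = \sum_i c i b *: e i by case: fr.
have ls (W : lmodType R) (f : V -> W) : linear f -> f b =
  \sum_i c i b *: f (e i).
  by move=> lf; rewrite {1}bE (linear_sum_fun _ _ _ lf).
rewrite /riemann (ls _ (fun b => 'D_b (fun y => Gamma y c' d) p)); last first.
  exact: (smooth_linear_derive (sG c' d)).1.
rewrite (ls _ (Gamma p ^~ (Gamma p c' d))); last exact: (Gamma_linear_l conn).
rewrite (ls _ (Gamma p ^~ d)); last exact: (Gamma_linear_l conn).
rewrite (linear_sum_fun _ _ _ (Gamma_linear_r conn c' Up)).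
have -> : 'D_c' (fun y => Gamma y b d) p = \sum_i c i b *: 'D_c' (fun y =>
  Gamma y (e i) d) p.
  rewrite (@derive_eq_on _ _ _ U _ (fun y =>
    \sum_i c i b *: Gamma y (e i) d)) //.
    rewrite (derive_sum_scale (a := fun i _ => c i b)); last 2 first.
    - by move=> i; exact: differentiable_cst.
    - by move=> i; exact: (smooth_on_diff (sG _ _) Up).
    by apply: eq_bigr => i _; rewrite derive_cst scale0r add0r.
  move=> y Uy; rewrite {1}bE.
  exact: (linear_sum_fun _ _ _ (Gamma_linear_l conn d Uy)).
rewrite -sumrB -big_split -sumrB; apply: eq_bigr => i _ /=.
by rewrite -scalerBr -scalerDr -scalerBr.
Qed.

Lemma riemann0m p b d : U p -> riemann Gamma p b 0 d = 0.
Proof.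
move=> Up; rewrite /riemann derive0.
rewrite (@derive_eq_on _ _ _ U _ (cst 0)) // ?derive_cst; last first.
  by move=> y Uy; exact: linear_fun0 (Gamma_linear_l conn d Uy).
rewrite (linear_fun0 (Gamma_linear_l conn d Up)).
rewrite (linear_fun0 (Gamma_linear_r conn b Up)).
by rewrite (linear_fun0 (Gamma_linear_l conn _ Up)) !subr0 addr0.
Qed.

Lemma riemann0r p b c' : U p -> riemann Gamma p b c' 0 = 0.
Proof.
move=> Up; rewrite /riemann.
have D0 u v : 'D_v (fun y => Gamma y u 0) p = 0.
  rewrite (@derive_eq_on _ _ _ U _ (cst 0)) // ?derive_cst // => y Uy.
  exact: linear_fun0 (Gamma_linear_r conn u Uy).
rewrite !D0 (linear_fun0 (Gamma_linear_r conn c' Up)).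
rewrite (linear_fun0 (Gamma_linear_r conn b Up)).
by rewrite (linear_fun0 (Gamma_linear_r conn _ Up)) !subr0 addr0.
Qed.

Lemma good_tensor_curvature : good_tensor (e := e) (c := c) (U :=
  U) X (curvature Gamma).
Proof.
have nrs B : nr B -> smooth_on U B by exact: null_or_radial_smooth.
have sc (b : V) : smooth_on U (cst b : V -> V) by exact: smooth_on_cst.
split=> [B C E sB sC sE|B C E p sB nC nE pL|B C E p sB nC nE CE pL].
- apply: smooth_onB => //; [apply: smooth_onB => //|].
  + by do 2!apply: (smooth_nabla fr oU conn) => //.
  + by do 2!apply: (smooth_nabla fr oU conn) => //.
  + by apply: (smooth_nabla fr oU conn) => //;
    exact: (smooth_lie_bracket fr oU).
- have Up := pL.1; rewrite (curvatureE fr oU conn) //; auto.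
  rewrite riemann_coord //; apply: eq_bigr => i _.
  by rewrite (curvatureE fr oU conn); auto.
- have Up := pL.1; rewrite (curvatureE fr oU conn) //; auto.
  by case: CE => -[_ ->] //; [exact: riemann0m|exact: riemann0r].
Qed.

(** The counterpart of [symm_nabla_curvature] for a field in place of a constant vector, kept as a
    field so that it can be differentiated again. *)
Definition curv_iter (k : nat) (B : V -> V) : V -> V :=
  iter_nabla Gamma (nabla13 Gamma) (curvature Gamma) (k := k) (fun=> cst X)
    B (cst X) (cst X).

Lemma good_tensor0 : good_tensor (e := e) (c := c) (U := U) X 0.
Proof.
split=> [B C E _ _ _|B C E p _ _ _ _|//]; first exact: smooth_on_cst.
by rewrite big1 // => i _; exact: scaler0.
Qed.

Lemma curv_iter_good k : good_tensor (e := e) (c := c) (U := U) X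
  (iter_nabla Gamma (nabla13 Gamma) (curvature Gamma) (k := k) (fun=> cst X)).
Proof.
apply: (iter_nabla_good fr oU conn GXX) => [||||i].
- exact: good_tensor0.
- by move=> s t; exact: (good_tensorB oU).
- by move=> A s; exact: (good_tensor_nabla fr oU conn GXX).
- exact: good_tensor_curvature.
- by right; exact: radial_cst.
Qed.

Let nrX : nr (cst X) := or_intror (radial_cst X).

Lemma curv_iter_smooth k B : smooth_on U B -> smooth_on U (curv_iter k B).
Proof.
by move=> sB; have [+ _ _] := curv_iter_good k; apply=> //;
  exact: smooth_on_cst.
Qed.

Lemma curv_iter_coord k B p : smooth_on U B -> onL p ->
  curv_iter k B p = \sum_i c i (B p) *: curv_iter k (cst (e i)) p.
Proof. by move=> sB pL; have [_ + _] := curv_iter_good k; exact. Qed.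

(** Of the three correction terms of [nabla13], the two containing nabla_X X vanish on the line.
    Read as a formula for N of [curv_iter k B], this is the product rule behind the Leibniz
    formula. *)
Lemma curv_iterS k B p : smooth_on U B -> onL p ->
  curv_iter k.+1 B p = N (curv_iter k B) p - curv_iter k (N B) p.
Proof.
move=> sB pL.
have sN A C : nr A -> smooth_on U C -> smooth_on U (nabla Gamma A C).
  by move=> nA sC; apply: (smooth_nabla fr oU conn) => //;
    exact: null_or_radial_smooth nA.
have nN A C : nr A -> nr C -> null_field (U := U) X (nabla Gamma A C).
  exact: (nabla_null fr oU conn GXX).
have nrN A C : nr A -> nr C -> nr (nabla Gamma A C) by move=> ? ?; left;
  exact: nN.
have H : null_tensor (U := U) X
    (iter_nabla Gamma (nabla13 Gamma) (curvature Gamma) (k :=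
      k.+1) (fun=> cst X)
     - nabla13 Gamma (cst X)
       (iter_nabla Gamma (nabla13 Gamma) (curvature Gamma) (k :=
         k) (fun=> cst X))).
  apply: (iter_nabla_radial fr oU conn GXX (Q := good_tensor (e := e) (c :=
    c) (U := U) X)).
  - exact: good_tensor0.
  - by move=> s t; exact: (good_tensorB oU).
  - by [].
  - by move=> s t s0 t0 B' C E q *;
    rewrite -[LHS]/(s B' C E q - t B' C E q) s0 // t0 // subrr.
  - by move=> A s; exact: (good_tensor_nabla fr oU conn GXX).
  - move=> A s rA [s1 _ _] s0 B' C E q sB' nC nE qL.
    rewrite nabla13E (nabla_radial0 oU conn rA) // => [|q' q'L]; last exact: s0.
    have nA : nr A by right.
    by rewrite !s0 ?subrr //; auto.
  - move=> A s n0 [s1 s2 s3] B' C E q sB' nC nE qL; have nA : nr A by left.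
    rewrite nabla13E (nabla_null_l conn _ n0) // s2; auto.
    rewrite (s3 _ (nabla Gamma A C)); [|by auto..|by left; auto|by []].
    rewrite (s3 _ _ (nabla Gamma A E)); [|by auto..|by right; auto|by []].
    rewrite big1 ?subrr // => i _.
    by rewrite (nabla_null_l conn _ n0) // linear0 scale0r.
  - exact: good_tensor_curvature.
have [T1 T2 T3] := curv_iter_good k.
have := H B (cst X) (cst X) p sB nrX nrX pL; rewrite /curv_iter.
set T := iter_nabla _ _ _ _; set T' := iter_nabla _ _ _ _ in T1 T2 T3 *.
rewrite -[X in X = _]/(T B (cst X) (cst X) p - nabla13 Gamma (cst X) T' B (cst
  X) (cst X) p) => /eqP.
rewrite subr_eq0 => /eqP ->.
rewrite nabla13E (T3 B (N (cst X)) (cst X)); [|by auto..|by left; auto|by []].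
by rewrite (T3 B (cst X) (N (cst X))) ?subr0 //; [auto|right; auto].
Qed.

End Curvature.

Arguments curv_iter {R V} Gamma X k B.

(** * Jacobi fields and the recursion *)

Section NormalCoordinates.
Context {R : realType} {V : normedModType R}.
Context {n : nat} {e : 'I_n -> V} {c : 'I_n -> {linear V -> R^o}}.
Context (fr : dual_frame e c) {U : set V} (oU : open U) (U0 : U 0).
Context {Gamma : V -> V -> V -> V} (conn : connection U Gamma).
Context (Gsym : forall x u v, U x -> Gamma x u v = Gamma x v u).
Context (Gxx : forall x, U x -> Gamma x x x = 0).

Lemma Gamma_smooth u v : smooth_on U (fun x => Gamma x u v).
Proof. exact: (connection_smooth conn u v). Qed.

Lemma Gamma_ZZ x a u v : U x -> Gamma x (a *: u) (a *: v) =
  (a * a) *: Gamma x u v.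
Proof.
move=> Ux; rewrite (linear_funZ _ _ (Gamma_linear_r conn _ Ux)).
by rewrite (linear_funZ _ _ (Gamma_linear_l conn _ Ux)) scalerA.
Qed.

Lemma near_ray_in (X : V) : \forall t \near (0 : R), U (t *: X).
Proof.
have cX : t *: X @[t --> (0 : R)] --> 0 *: X by exact: scalel_continuous.
by apply: cX; rewrite scale0r; exact: open_nbhs_nbhs.
Qed.

Lemma Gamma_ray_neq0 (X : V) (t : R) : t != 0 -> U (t *: X) ->
  Gamma (t *: X) X X = 0.
Proof.
move=> t0 Ut; have := Gxx Ut; rewrite Gamma_ZZ // => /eqP.
by rewrite scaler_eq0 mulf_eq0 (negbTE t0) => /eqP.
Qed.

(** At the origin Gamma_x(x, x) = 0 says nothing about [X]; the value is a limit along the ray,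
    where homogeneity allows division by t^2. *)
Lemma Gamma0_diag (X : V) : Gamma 0 X X = 0.
Proof.
have cG : Gamma x X X @[x --> (0 : V)] --> Gamma 0 X X.
  exact: (differentiable_continuous (smooth_on_diff (Gamma_smooth X X) U0)).
have cX : t *: X @[t --> (0 : R)^'] --> (0 : V).
  apply: cvg_within_filter.
  have cX : t *: X @[t --> (0 : R)] --> 0 *: X by exact: scalel_continuous.
  by rewrite scale0r in cX.
have c0 : Gamma (t *: X) X X @[t --> (0 : R)^'] --> Gamma 0 X X.
  exact: (@cvg_comp _ _ _ (fun t : R => t *: X) (fun x =>
    Gamma x X X) _ _ _ cX cG).
have c1 : Gamma (t *: X) X X @[t --> (0 : R)^'] --> (0 : V).
  apply: cvg_near_cst; near=> t; apply/eqP; rewrite Gamma_ray_neq0 //.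
    by near: t; exact: nbhs_dnbhs_neq.
  by near: t; apply: nbhs_dnbhs; exact: near_ray_in.
exact: (cvg_unique _ c0 c1).
Unshelve. all: by end_near. Qed.

(** Polarization of the diagonal identity, using symmetry. *)
Lemma Gamma0 (u v : V) : Gamma 0 u v = 0.
Proof.
have := Gamma0_diag (u + v).
rewrite (linear_funD _ _ (Gamma_linear_r conn _ U0)).
rewrite !(linear_funD _ _ (Gamma_linear_l conn _ U0)) !Gamma0_diag.
rewrite add0r addr0 (Gsym _ _ U0) -mulr2n -scaler_nat => /eqP.
by rewrite scaler_eq0 pnatr_eq0 => /eqP.
Qed.

Lemma Gamma_ray (X p : V) : on_line (U := U) X p -> Gamma p X X = 0.
Proof.
move=> [Up [t pE]]; have [t0|t0] := eqVneq t 0; first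
  by rewrite pE t0 scale0r Gamma0.
by rewrite pE Gamma_ray_neq0 // -pE.
Qed.

(** The derivative of Gamma_y(y, y) = 0 in the direction [Y]; symmetry merges the two terms in which
    an argument is differentiated. *)
Lemma derive_Gamma_diag (p Y : V) : U p ->
  'D_Y (fun y => Gamma y p p) p + 2 *: Gamma p p Y = 0.
Proof.
move=> Up; have := derive_Gamma fr oU conn Y (smooth_on_id (U :=
  U)) (smooth_on_id (U := U)) Up.
rewrite (@derive_eq_on _ _ _ U _ (cst 0)) // derive_cst derive_id (Gsym Y) //=.
by rewrite -addrA -mulr2n scaler_nat.
Qed.

Section Ray.
Variable X : V.
Notation onL := (on_line (U := U) X).
Notation N := (nabla Gamma (cst X)).

Lemma nabla_cst (u v : V) : nabla Gamma (cst u) (cst v) = fun x => Gamma x u v.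
Proof. by apply/funext => x; rewrite nablaE derive_cst add0r. Qed.

(* The fields t * Y along the rays are Jacobi fields. *)
Lemma jacobi (Y : V) (t : R) : U (t *: X) ->
  2 *: N (cst Y) (t *: X)
  + t *: (N (N (cst Y)) (t *: X) +
    curvature Gamma (cst Y) (cst X) (cst X) (t *: X)) = 0.
Proof.
move=> Ut; set p := t *: X; have pL : onL p by split=> //; exists t.
have scst (v : V) : smooth_on U (cst v : V -> V) by exact: smooth_on_cst.
(* As N Y = Gamma(X, Y), the terms D_X Gamma(X, Y) and Gamma(X, Gamma(X, Y)) of N N Y cancel against
   the curvature, and Gamma(X, X) = 0 on the line. *)
have -> : N (N (cst Y)) p + curvature Gamma (cst Y) (cst X) (cst X) p =
    'D_Y (fun y => Gamma y X X) p.
  rewrite (curvatureE fr oU conn) // /riemann !nabla_cst nablaE Gamma_ray //.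
  rewrite (linear_fun0 (Gamma_linear_r conn _ Ut)) addr0 (Gsym Y X Ut).
  rewrite (@derive_eq_on _ _ _ U (fun y => Gamma y Y X) (fun y =>
    Gamma y X Y)) //; last first.
    by move=> y Uy; exact: Gsym.
  by rewrite addrC -[_ - _ - _]addrA -opprD subrK.
have [t0|t0] := eqVneq t 0.
  by rewrite nabla_cst /p t0 scale0r Gamma0 scaler0 scale0r addr0.
have GpY : Gamma p p Y = t *: Gamma p X Y.
  exact: (linear_funZ _ _ (Gamma_linear_l conn Y Ut)).
have DY : 'D_Y (fun y => Gamma y p p) p = (t * t) *: 'D_Y (fun y =>
  Gamma y X X) p.
  rewrite (@derive_eq_on _ _ _ U _ (fun y => (t * t) *: Gamma y X X)) //;
    last first.
    by move=> y Uy; rewrite Gamma_ZZ.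
  by apply: deriveZ; apply: diff_derivable;
    exact: (smooth_on_diff (Gamma_smooth X X) Ut).
(* With p = tX this is t times the claim, hence the separate treatment of t = 0. *)
have := derive_Gamma_diag Y Ut; rewrite GpY DY nabla_cst => H.
apply: (scalerI t0); rewrite scaler0 -[RHS]H addrC scalerDr !scalerA.
by rewrite [t * 2]mulrC.
Qed.

Lemma nabla_lin (F G : V -> V) (a : R) p : smooth_on U F -> smooth_on U G ->
  U p ->
  N (fun x => F x + a *: G x) p = N F p + a *: N G p.
Proof.
move=> sF' sG Up; have dF := smooth_on_diff sF' Up; have dG :=
  smooth_on_diff sG Up.
rewrite !nablaE deriveD; last 2 first.
- exact: diff_derivable.
- by apply: diff_derivable; exact: (differentiableZ a dG).
have -> : 'D_X (fun x => a *: G x) p = a *: 'D_X G p.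
  by apply: deriveZ; exact: diff_derivable.
have lG := Gamma_linear_r conn X Up.
by rewrite (linear_funD _ _ lG) (linear_funZ _ _ lG) scalerDr addrACA.
Qed.

Lemma iter_nabla_lin (F G : V -> V) (a : R) k p : smooth_on U F ->
  smooth_on U G -> U p ->
  iter k N (fun x => F x + a *: G x) p = iter k N F p + a *: iter k N G p.
Proof.
move=> sF sG; elim: k p => //= k IH p Up.
rewrite -nabla_lin //; [|exact: (smooth_iter_nabla_cst fr oU conn)..].
rewrite !nablaE (derive_eq_on X oU _ Up (g := fun x => iter k N F x +
  a *: iter k N G x)) //.
by rewrite IH.
Qed.

(** One application of N to A + tB. The parameter t is not a field on V, so the ordinary derivative
    is taken in t alone; the connection terms add up to Gamma(X, A + tB) = 0. *)
Lemma nabla_line_affine (A B : V -> V) : smooth_on U A -> smooth_on U B ->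
  (forall t : R, U (t *: X) -> A (t *: X) + t *: B (t *: X) = 0) ->
  forall t : R, U (t *: X) -> (N A (t *: X) + B (t *: X)) +
    t *: N B (t *: X) = 0.
Proof.
move=> sA sB AB t Ut.
have dl F : smooth_on U F -> is_derive t (1 : R) (fun s =>
  F (s *: X)) ('D_X F (t *: X)).
  move=> sF; have := smooth_on_is_derive X sF Ut; rewrite -[t *: X]addr0 => H.
  have := is_derive_line H; rewrite (_ : (fun s => _) = fun s => F (s *: X)) //.
  by apply/funext => s; rewrite addr0.
have H : is_derive t (1 : R) (fun s => A (s *: X) + s *: B (s *: X))
    ('D_X A (t *: X) + (B (t *: X) + t *: 'D_X B (t *: X))).
  apply: is_deriveD; first exact: dl.
  rewrite -[X in X + _](scale1r (B _)).
  by apply: is_derive_scale; exact: dl.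
have : 'D_1 (fun s : R => A (s *: X) + s *: B (s *: X)) t = 0.
  rewrite (near_eq_derive (g := cst 0)) ?derive_cst //.
  have ct : s *: X @[s --> t] --> t *: X by exact: scalel_continuous.
  have nU : nbhs (t *: X) U by exact: open_nbhs_nbhs.
  have nt : \forall s \near t, U (s *: X) by exact: ct _ nU.
  by apply: filterS nt => s; exact: AB.
rewrite (@derive_val _ _ _ _ _ _ _ H) => D0.
have := AB t Ut; rewrite !nablaE => AB0.
have G0 : Gamma (t *: X) X (A (t *: X)) + t *: Gamma (t *: X) X (B (t *: X)) =
  0.
  have lG := Gamma_linear_r conn X Ut.
  by rewrite -(linear_funZ _ _ lG) -(linear_funD _ _ lG) AB0 (linear_fun0 lG).
rewrite scalerDr [X in X + _]addrAC addrACA G0 addr0.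
by move: D0; rewrite addrA.
Qed.

(** Leibniz for N^(k+1)(tB): t has derivative 1 and no higher ones, so B is left with the factor
    k+1, and the remaining term carries t and dies at 0. *)
Lemma nabla_line_iter (A B : V -> V) k : smooth_on U A -> smooth_on U B ->
  (forall t : R, U (t *: X) -> A (t *: X) + t *: B (t *: X) = 0) ->
  iter k.+1 N A 0 + k.+1%:R *: iter k N B 0 = 0.
Proof.
move=> sA sB AB.
have sI F j : smooth_on U F -> smooth_on U (iter j N F).
  by move=> sF; exact: (smooth_iter_nabla_cst fr oU conn).
have sF j : smooth_on U (fun x => iter j.+1 N A x + j.+1%:R *: iter j N B x).
  apply: smooth_onD => //; first exact: sI.
  by apply: (smooth_on_scale (a := cst _)) => //;
    [exact: smooth_on_cst|exact: sI].
suff H : forall t : R, U (t *: X) ->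
    (iter k.+1 N A (t *: X) + k.+1%:R *: iter k N B (t *: X)) +
      t *: iter k.+1 N B (t *: X) = 0.
  by have := H 0; rewrite scale0r => /(_ U0); rewrite scale0r addr0.
elim: k => [|k IH] t Ut.
  by rewrite scale1r; exact: nabla_line_affine.
have H := nabla_line_affine (sF k) (sI _ k.+1 sB) IH Ut.
rewrite nabla_lin // in H; [|exact: sI..].
by rewrite -[k.+2%:R]natr1 scalerDl scale1r addrA.
Qed.

End Ray.
End NormalCoordinates.

Section Recursion.
Context {R : realType} {V : normedModType R}.
Context {n : nat} {e : 'I_n -> V} {c : 'I_n -> {linear V -> R^o}}.
Context (fr : dual_frame e c) {U : set V} (oU : open U) (U0 : U 0).
Context {Gamma : V -> V -> V -> V} (conn : connection U Gamma).
Context (Gsym : forall x u v, U x -> Gamma x u v = Gamma x v u).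
Context (Gxx : forall x, U x -> Gamma x x x = 0) (X : V).

Notation onL := (on_line (U := U) X).
Notation N := (nabla Gamma (cst X)).

Let GXX p : onL p -> Gamma p X X = 0.
Proof. exact: Gamma_ray. Qed.

Let smooth_N k B : smooth_on U B -> smooth_on U (iter k N B).
Proof. exact: (smooth_iter_nabla_cst fr oU conn). Qed.

(** [curv_iterS] raises either the order of the curvature or the power of N on [B]; Pascal's rule in
    [sum_binS] collects the terms. *)
Lemma nabla_curv_leibniz m B p : smooth_on U B -> onL p ->
  iter m N (curv_iter Gamma X 0 B) p =
  \sum_(j < m.+1) 'C(m, j)%:R *: curv_iter Gamma X j (iter (m - j) N B) p.
Proof.
move=> sB; elim: m p => [|m IH] p pL.
  by rewrite big_ord1 bin0 scale1r subn0.
have Up := pL.1; rewrite iterS.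
rewrite (nabla_radial_eq oU (radial_cst X) IH pL) (nabla_sum conn) //;
  last first.
  move=> i; apply: (smooth_on_diff _ Up).
  by apply: (curv_iter_smooth fr oU conn GXX); exact: smooth_N.
rewrite (sum_binS m (fun j => curv_iter Gamma X j (iter (m.+1 - j) N B) p)).
rewrite -big_split; apply: eq_bigr => j _ /=.
have jm : (j <= m)%N by rewrite -ltnS.
have -> : (m.+1 - j.+1 = m - j)%N by [].
have -> : (m.+1 - j = (m - j).+1)%N by rewrite subSn.
rewrite [X in X *: _ + _](derive_cst ('C(m, j)%:R : R^o)) scale0r add0r.
rewrite -scalerDr; congr (_ *: _).
by rewrite (curv_iterS fr oU conn GXX _ (smooth_N _ sB) pL) [RHS]addrC subrK.
Qed.

Lemma curv_iter_value k B : smooth_on U B ->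
  curv_iter Gamma X k B 0 = symm_nabla_curvature Gamma k X (B 0).
Proof.
have L0 : onL 0 by split=> //; exists 0; rewrite scale0r.
move=> sB; apply: etrans (curv_iter_coord fr oU conn GXX k sB L0) _.
exact: esym (curv_iter_coord fr oU conn GXX k (smooth_on_cst (B 0)) L0).
Qed.

Lemma symm_nabla_curvature_linear k : linear (symm_nabla_curvature Gamma k X).
Proof.
have L0 : onL 0 by split=> //; exists 0; rewrite scale0r.
have E v := curv_iter_coord fr oU conn GXX k (smooth_on_cst v) L0.
move=> a u v; apply: etrans (E (a *: u + v)) _.
rewrite -[symm_nabla_curvature Gamma k X u]/(curv_iter Gamma X k (cst u) 0).
rewrite -[symm_nabla_curvature Gamma k X v]/(curv_iter Gamma X k (cst v) 0).
rewrite !E scaler_sumr -big_split.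
by apply: eq_bigr => i _ /=; rewrite linearP scalerDl scalerA.
Qed.

Lemma iter_nabla_cst1 (Y : V) : iter 1 N (cst Y) 0 = 0.
Proof. by rewrite /= nabla_cst (Gamma0 oU U0 conn Gsym Gxx). Qed.

Lemma iter_nabla_cst_rec (Y : V) m :
  iter m.+2 N (cst Y) 0 = - (m.+1%:R / m.+3%:R) *:
    \sum_(j < m.+1) 'C(m, j)%:R *:
    symm_nabla_curvature Gamma j X (iter (m - j) N (cst Y) 0).
Proof.
have L0 : onL 0 by split=> //; exists 0; rewrite scale0r.
have sY : smooth_on U (cst Y : V -> V) by exact: smooth_on_cst.
pose F := N (cst Y); have sF : smooth_on U F by exact: (smooth_N 1).
pose C0 := curv_iter Gamma X 0 (cst Y).
have sC : smooth_on U C0 by exact: (curv_iter_smooth fr oU conn GXX).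
have sNF : smooth_on U (N F) by exact: (smooth_N 2).
(* The Jacobi equation as A + tB = 0, with A = 2 N Y and B = N N Y + R(Y, X)X; the coefficients 1
   give both sums the shape of [iter_nabla_lin]. *)
have H t : U (t *: X) -> (F (t *: X) + 1 *: F (t *: X)) +
    t *: (N F (t *: X) + 1 *: C0 (t *: X)) = 0.
  move=> Ut; rewrite !scale1r -mulr2n -scaler_nat.
  exact: (jacobi fr oU U0 conn Gsym Gxx).
have sA : smooth_on U (fun x => F x + 1 *: F x).
  by apply: smooth_onD => //; apply: (smooth_on_scale (a := cst _)) => //;
    exact: smooth_on_cst.
have sB : smooth_on U (fun x => N F x + 1 *: C0 x).
  by apply: smooth_onD => //; apply: (smooth_on_scale (a := cst _)) => //;
    exact: smooth_on_cst.
have := nabla_line_iter fr oU U0 conn m sA sB H.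
rewrite !(iter_nabla_lin fr oU conn) // !scale1r.
have E1 : iter m.+1 N F 0 = iter m.+2 N (cst Y) 0 by rewrite [in RHS]iterSr.
have E2 : iter m N (N F) 0 = iter m.+2 N (cst Y) 0
  by rewrite [in RHS]iterSr [in RHS]iterSr.
rewrite E1 E2 nabla_curv_leibniz //.
under eq_bigr => j _ do rewrite (curv_iter_value _ (smooth_N _ sY)).
set S := \sum_(_ < _) _; set w := iter _ _ _ _.
(* The equation is 2w + (m+1)(w + S) = 0, that is (m+3) w = -(m+1) S. *)
rewrite scalerDr addrA -mulr2n -[w *+ 2]scaler_nat -scalerDl -natrD => /eqP.
rewrite addr_eq0 => /eqP wE.
have n0 : (2 + m.+1)%:R != 0 :> R by rewrite pnatr_eq0.
apply: (scalerI n0); rewrite wE scalerA mulrN mulrCA mulfV // mulr1.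
by rewrite scaleNr.
Qed.

End Recursion.

(** * Evaluation in the free algebra *)

Section FreeEval.
Context {R : realType} {V : lmodType R} (r : nat -> V -> V).
Implicit Types (p q : free_algebra R) (Y : V).

Local Notation eval_word w Y := (foldr r Y (fmonom_val w)).

(** The support of a sum may shrink by cancellation; a larger common list of words makes evaluation
    additive. *)
Lemma free_evalEw (s : seq (fmonom nat)) p Y :
  uniq s -> (forall w, mcoeff w p != 0 -> w \in s) ->
  free_eval r p Y = \sum_(w <- s) mcoeff w p *: eval_word w Y.
Proof.
move=> us ps; rewrite /free_eval.
pose P w := w \in finmap.enum_fset (msupp p).
have PE w : (mcoeff w p != 0) = P w by exact: mcoeff_neq0.
rewrite [RHS](bigID P) /=.
rewrite [X in _ = _ + X]big1 ?addr0 => [|w]; last first.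
  by rewrite -PE negbK => /eqP ->; rewrite scale0r.
have E : perm_eq (finmap.enum_fset (msupp p)) [seq w <- s | P w].
  apply: uniq_perm; [exact: finmap.fset_uniq|exact: filter_uniq|].
  move=> w; rewrite mem_filter -/(P w).
  by case Pw: (P w); rewrite //= ps // PE.
by rewrite -[RHS]big_filter; exact: perm_big.
Qed.

Lemma free_evalZD a p q Y :
  free_eval r (a *: p + q) Y = a *: free_eval r p Y + free_eval r q Y.
Proof.
pose s := undup (finmap.enum_fset (msupp p) ++ finmap.enum_fset (msupp q)).
have us : uniq s by exact: undup_uniq.
have mp w : mcoeff w p != 0 -> w \in s.
  by rewrite mcoeff_neq0 mem_undup mem_cat => wp; apply/orP; left.
have mq w : mcoeff w q != 0 -> w \in s.
  by rewrite mcoeff_neq0 mem_undup mem_cat => wq; apply/orP; right.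
have mE w : mcoeff w (a *: p + q) = a * mcoeff w p + mcoeff w q.
  by rewrite mcoeffD mcoeffZ.
rewrite (free_evalEw Y us mp) (free_evalEw Y us mq) (@free_evalEw s) //.
  rewrite scaler_sumr -big_split; apply: eq_bigr => w _ /=.
  by rewrite mE scalerDl scalerA.
move=> w; rewrite mE; apply: contraNT => ws.
have /eqP -> : mcoeff w p == 0 by apply: contraNT ws => /mp.
have /eqP -> : mcoeff w q == 0 by apply: contraNT ws => /mq.
by rewrite mulr0 addr0.
Qed.

Lemma free_eval0 Y : free_eval r 0 Y = 0.
Proof. by rewrite (@free_evalEw [::]) ?big_nil // => w;
  rewrite mcoeff0 eqxx. Qed.

Lemma free_evalZ a p Y : free_eval r (a *: p) Y = a *: free_eval r p Y.
Proof. by have := free_evalZD a p 0 Y; rewrite !addr0 free_eval0 addr0. Qed.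

Lemma free_evalD p q Y : free_eval r (p + q) Y = free_eval r p Y +
  free_eval r q Y.
Proof. by have := free_evalZD 1 p q Y; rewrite !scale1r. Qed.

Lemma free_eval_sum (I : Type) (s : seq I) (F : I -> free_algebra R) Y :
  free_eval r (\sum_(i <- s) F i) Y = \sum_(i <- s) free_eval r (F i) Y.
Proof.
elim: s => [|i s IH]; first by rewrite !big_nil free_eval0.
by rewrite !big_cons free_evalD IH.
Qed.

Lemma free_evalU (a : R) (w : fmonom nat) Y :
  free_eval r (mkmalgU w a) Y = a *: eval_word w Y.
Proof.
rewrite (@free_evalEw [:: w]) ?big_seq1 ?mcoeffUU // => v.
by rewrite mcoeffU inE [v == w]eq_sym; case: (w == v); rewrite //= eqxx.
Qed.

Lemma free_eval1 Y : free_eval r 1 Y = Y.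
Proof. by rewrite (free_evalU 1 (monalg.one : fmonom nat)) scale1r fm1. Qed.

Lemma free_eval_varM j p Y : linear (r j) ->
  free_eval r (free_var j * p) Y = r j (free_eval r p Y).
Proof.
move=> lr; rewrite {1}(monalgE p) mulr_sumr free_eval_sum /free_eval.
rewrite (linear_sum_fun _ _ _ lr); apply: eq_bigr => w _.
rewrite malgM_def fgmulUU mul1r; apply: etrans (free_evalU _ _ Y) _;
  congr (_ *: _).
by rewrite fmM fmU.
Qed.

End FreeEval.

Section Qtilde.
Context {R : realType} {V : lmodType R} (r : nat -> V -> V).

Lemma free_eval_Qtilde0 Y : free_eval r (Qtilde (R := R) 0) Y = Y.
Proof. exact: free_eval1. Qed.

Lemma free_eval_Qtilde1 Y : free_eval r (Qtilde (R := R) 1) Y = 0.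
Proof. exact: free_eval0. Qed.

Lemma free_eval_Qtilde_rec k Y : (forall j, linear (r j)) ->
  free_eval r (Qtilde (R := R) k.+2) Y = - (k.+1%:R / k.+3%:R) *:
    \sum_(j < k.+1) 'C(k, j)%:R *: r j (free_eval r (Qtilde (k - j)) Y).
Proof.
move=> lr; rewrite /= free_evalZ free_eval_sum; congr (_ *: _).
by apply: eq_bigr => j _; rewrite free_evalZ free_eval_varM.
Qed.

Lemma free_eval_Qtilde_unique Y (w : nat -> V) : (forall j, linear (r j)) ->
  w 0 = Y -> w 1 = 0 ->
  (forall k, w k.+2 = - (k.+1%:R / k.+3%:R) *:
    \sum_(j < k.+1) 'C(k, j)%:R *: r j (w (k - j)%N)) ->
  forall k, w k = free_eval r (Qtilde (R := R) k) Y.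
Proof.
move=> lr w0 w1 wS; elim/ltn_ind => -[_|[_|k IH]].
- by rewrite free_eval_Qtilde0.
- by rewrite free_eval_Qtilde1.
- rewrite wS free_eval_Qtilde_rec //; congr (_ *: _).
  apply: eq_bigr => j _; rewrite IH // ltnS (leq_trans (leq_subr _ _)) //.
Qed.

End Qtilde.

(** * Estimates *)

Section VectorCalculus.
Context {R : realType} {V : normedModType R}.

Lemma is_derive_lineP (W : normedModType R) (f : V -> W) (u p : V) df :
  is_derive p u f df <-> is_derive (0 : R) (1 : R) (fun s => f (s *: u + p)) df.
Proof.
have E : (fun h : R => h^-1 *: (((fun s => f (s *: u + p)) \o shift 0) (h *: 1)
     - f (0 *: u + p))) =
  (fun h => h^-1 *: ((f \o shift p) (h *: u) - f p)).
  by apply/funext => h /=; rewrite [_%:A]mulr1 addr0 scale0r add0r.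
by split=> -[df1 df2]; split; move: df1 df2; rewrite /derivable /derive E.
Qed.

(** Multiplying the difference quotient by [h] makes the condition trivial at 0, so a full
    neighbourhood replaces the punctured one. *)
Lemma is_derive1P (f : R -> V) (t : R) (d : V) : is_derive t (1 : R) f d <->
  forall eps, 0 < eps -> \forall h \near (0 : R), `|f (h +
    t) - f t - h *: d| <= eps * `|h|.
Proof.
split=> [[df Df] eps eps0|H].
  have /derivable_nbhsP/eqaddoP/(_ _ eps0) := df; rewrite Df;
    apply: filterS => h /=.
  rewrite -![(_ + _ : _ -> _) _]/(_ + _) -![(- _ : _ -> _) _]/(- _) /=.
  by rewrite [_%:A]mulr1 opprD addrA.
suff cv : (fun h : R => h^-1 *: ((f \o shift t) (h *: 1) - f t)) @ 0^' --> d.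
  by split; [apply/cvg_ex; exists d; exact: cv|exact: cvg_lim cv].
apply/cvgrPdist_le => eps eps0; have := H _ eps0.
move=> /(@nbhs_dnbhs _ (0 : R)) => Hd; near=> h.
have h0 : h != 0 by near: h; exact: nbhs_dnbhs_neq.
have : `|f (h + t) - f t - h *: d| <= eps * `|h| by near: h.
move=> le; rewrite /= [_%:A]mulr1 distrC -(@ler_pM2r _ `|h|) ?normr_gt0 //
  mulrC.
by rewrite -normrZ scalerBr scalerA mulfV // scale1r.
Unshelve. all: by end_near. Qed.

(** Serves to join, at the origin, parallel fields along two opposite rays. *)
Lemma is_derive_glue (f g : R -> V) (t : R) d : f t = g t ->
  is_derive t (1 : R) f d -> is_derive t (1 : R) g d ->
  is_derive t (1 : R) (fun s => if t <= s then f s else g s) d.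
Proof.
move=> fg /is_derive1P df /is_derive1P dg; apply/is_derive1P => eps eps0.
near=> h; rewrite lexx; case: ifP => _; last rewrite fg.
  by near: h; exact: df.
by near: h; exact: dg.
Unshelve. all: by end_near. Qed.

Lemma is_derive_cst_line (f : R -> V) (a t : R) d :
  is_derive (a * t) (1 : R) f d -> is_derive t (1 : R) (fun s =>
    f (a * s)) (a *: d).
Proof.
have [->|a0] := eqVneq a 0.
  move=> _; rewrite scale0r (_ : (fun s => _) = cst (f 0));
    first exact: is_derive_cst.
  by apply/funext => s; rewrite mul0r.
move=> /is_derive1P df; apply/is_derive1P => eps eps0.
have e0 : 0 < eps / `|a| by rewrite divr_gt0 // normr_gt0.
have ca : a * h @[h --> (0 : R)] --> a * 0 by exact: (@mulrl_continuous R a 0).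
rewrite mulr0 in ca.
have nH : \forall h \near (0 : R), `|f (a * h +
  a * t) - f (a * t) - (a * h) *: d| <=
    eps / `|a| * `|a * h| by exact: ca _ (df _ e0).
apply: filterS nH => h /=.
rewrite mulrDr normrM mulrA divfK ?normr_eq0 // scalerA.
by rewrite [h * a]mulrC.
Qed.

Context {n : nat} {e : 'I_n -> V} {c : 'I_n -> {linear V -> R^o}}.
Context (fr : dual_frame e c).

Lemma frame_lipschitz : exists2 k : R, 0 <= k & forall i v, `|c i v : R^o| <=
  k * `|v|.
Proof.
have [cc _ _] := fr.
have kP i : exists k : R, 0 <= k /\ forall v, `|c i v : R^o| <= k * `|v|.
  by have [k k0 kle] := linear_lipschitz (cc i); exists k; split => //;
    exact: ltW.
pose k i := projT1 (cid (kP i)).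
have k0 i : 0 <= k i by rewrite /k; case: cid => ? [].
have kle i v : `|c i v : R^o| <= k i * `|v| by rewrite /k; case: cid => ? [].
exists (\sum_i k i); first exact: sumr_ge0.
move=> i v; rewrite (le_trans (kle i v)) // ler_wpM2r //.
by rewrite (bigD1 i) //= lerDl sumr_ge0.
Qed.

(** [K] is the price of arguing coordinatewise in an arbitrary norm; it depends on the frame only,
    and the radius of the ball is chosen later to absorb it. *)
Definition mean_value_const (K : R) :=
  forall (f df : R -> V) (a b M : R), a <= b ->
  (forall t, a <= t <= b -> is_derive t (1 : R) f (df t)) ->
  (forall t, a <= t <= b -> `|df t| <= M) ->
  `|f b - f a| <= K * M * (b - a).

Lemma mean_value_ineq : exists2 K : R, 0 <= K & mean_value_const K.
Proof.
have [k k0 kle] := frame_lipschitz; have [cc cE _] := fr.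
exists (\sum_i k * `|e i|); first by apply: sumr_ge0 => i _; rewrite mulr_ge0.
move=> f df a b M; rewrite le_eqVlt => /predU1P[<- _ _|ab fd dfM].
  by rewrite !subrr normr0 mulr0.
have le i : `|c i (f b - f a) : R^o| <= k * M * (b - a).
  have dcf t : a <= t <= b -> is_derive t (1 : R) (fun s =>
    c i (f s) : R^o) (c i (df t)).
    move=> tab; have [d1 d2] := fd t tab.
    have dft : differentiable f t by exact/derivable1_diffP.
    have := @derive_linear_comp R R V R^o (c i) f t 1 (cc i) dft;
      rewrite d2 => H.
    split=> //; apply/derivable1_diffP/differentiable_comp => //.
    exact: linear_differentiable.
  have [t tab E] := @MVT_derive R (fun s => c i (f s)) a b ab
    (fun t tab => @ex_derive _ _ _ _ _ _ _ (dcf t tab)).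
  have {}tab : a <= t <= b by move: tab => /andP[? ?]; rewrite !ltW.
  rewrite linearB /= E (@derive_val _ _ _ _ _ _ _ (dcf t tab)) normrM.
  have ba : 0 <= b - a by rewrite subr_ge0 ltW.
  rewrite [`|b - a|]ger0_norm // ler_wpM2r //.
  by rewrite (le_trans (kle _ _)) // ler_wpM2l // dfM.
rewrite {1}(cE (f b - f a)) (le_trans (ler_norm_sum _ _ _)) // -mulrA mulr_suml.
apply: ler_sum => i _; rewrite normrZ mulrAC ler_wpM2r //.
by rewrite mulrA; exact: le.
Qed.

End VectorCalculus.

Lemma derive1_ray (R : realType) (V : normedModType R) (x : V) :
  derive1 (ray x) = cst x.
Proof.
apply/funext => t; rewrite derive1E.
have H := is_derive_scale (is_derive_id t (1 : R)) (is_derive_cst x t (1 : R)).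
by rewrite (@derive_val _ _ _ _ _ _ _ H) scale1r scaler0 addr0.
Qed.

Section Bounds.
Context {R : realType} {V : normedModType R}.

(** Induction on the order: the derivative of the remainder of [phi] is the remainder of the shifted
    sequence, and each integration costs a factor [K]. The factorial is lost, but only the power of
    |X| contained in M matters later. *)
Lemma taylor_inequality (K : R) : 0 <= K -> mean_value_const (V := V) K ->
  forall m (phi : nat -> R -> V) (M : R), 0 <= M ->
  (forall k (t : R), 0 <= t <= 1 -> is_derive t (1 : R) (phi k) (phi k.+1 t)) ->
  (forall t : R, 0 <= t <= 1 -> `|phi m t| <= M) ->
  forall t : R, 0 <= t <= 1 ->
  `|phi 0 t - \sum_(k < m) (t ^+ k / k`!%:R) *: phi k 0| <= K ^+ m * M.
Proof.
move=> K0 mv; elim=> [|m IH] phi M M0 dphi phiM t t01.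
  by rewrite big_ord0 subr0 expr0 mul1r; exact: phiM.
have /andP[t0 t1] := t01.
pose psi (s : R) := phi 0 s - \sum_(k < m.+1) (s ^+ k / k`!%:R) *: phi k 0.
pose dpsi (s : R) := phi 1 s - \sum_(k < m) (s ^+ k / k`!%:R) *: phi k.+1 0.
have dle (s : R) : 0 <= s <= 1 -> `|dpsi s| <= K ^+ m * M.
  by move=> s01; exact: (IH (fun k => phi k.+1)) s01.
have dpsiP (s : R) : 0 <= s <= 1 -> is_derive s (1 : R) psi (dpsi s).
  move=> s01; apply: is_deriveB; first exact: dphi.
  rewrite (_ : (fun s0 : R => _) = \sum_(k < m.+1) (fun s : R =>
    (s ^+ k / k`!%:R) *: phi k 0)); last first.
    by apply/funext => r; rewrite fct_sumE.
  rewrite big_ord_recl (_ : (fun s0 : R => _) = cst (phi 0 0)); last first.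
    by apply/funext => r; rewrite expr0 fact0 divr1 scale1r.
  rewrite -[\sum_(k < m) _ *: _]add0r; apply: is_deriveD.
  apply: is_derive_sum => k.
  have dX : is_derive s (1 : R) (fun r : R =>
    r ^+ k.+1 / k.+1`!%:R : R^o) (s ^+ k / k`!%:R).
    have dX := is_deriveX k.+1 (is_derive_id s (1 : R)).
    have := is_derive_scale (is_derive_cst (k.+1`!%:R^-1 : R^o) s (1 : R)) dX.
    rewrite (_ : (fun r => _) = fun r : R => r ^+ k.+1 / k.+1`!%:R); last first.
      by apply/funext => r; rewrite exprfctE -[_ *: _]/(_ * _) mulrC.
    move=> H; apply: is_derive_eq H _; rewrite scale0r add0r.
    have fE : k.+1`!%:R^-1 * k.+1%:R = k`!%:R^-1 :> R.
      by rewrite factS natrM invfM mulrAC mulVf ?mul1r // pnatr_eq0.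
    by rewrite -![_ *: _]/(_ * _) mulr1 mulrA fE /= mulrC.
  have := is_derive_scale dX (is_derive_cst (phi k.+1 0) s (1 : R)).
  by rewrite scaler0 addr0.
have psi0 : psi 0 = 0.
  rewrite /psi big_ord_recl expr0 fact0 divr1 scale1r big1 ?addr0 ?subrr // =>
    k _.
  by rewrite exprS mul0r mul0r scale0r.
have := mv psi dpsi 0 t (K ^+ m * M) t0.
rewrite psi0 !subr0 => H; apply: (@le_trans _ _ (K * (K ^+ m * M) * t)).
  by apply: H => s /andP[s0 st]; [apply: dpsiP|apply: dle];
    rewrite s0 (le_trans st).
by rewrite exprS -[leRHS]mulrA ler_piMr // !mulr_ge0 // exprn_ge0.
Qed.

Context {n : nat} {e : 'I_n -> V} {c : 'I_n -> {linear V -> R^o}}.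
Context (fr : dual_frame e c) {U : set V} (oU : open U) (U0 : U 0).
Context {Gamma : V -> V -> V -> V} (conn : connection U Gamma).

Lemma near0_bounded (F : V -> V) : smooth_on U F ->
  exists2 M : R, 0 <= M & \forall x \near 0, `|F x| <= M.
Proof.
move=> sF; exists (`|F 0| + 1); first by rewrite addr_ge0.
have cF := differentiable_continuous (smooth_on_diff sF U0).
have /cvgrPdist_le/(_ 1 ltr01) := cF; apply: filterS => x le.
by rewrite -[F x](subrK (F 0)) addrC (le_trans (ler_normD _ _)) // lerD2l
  distrC.
Qed.

Lemma Gamma_bounded : exists2 C : R, 0 <= C &
  \forall x \near 0, forall u v, `|Gamma x u v| <= C * `|u| * `|v|.
Proof.
have [k k0 kle] := frame_lipschitz fr.
have bP i j := near0_bounded (connection_smooth conn (e i) (e j)).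
pose M i j := projT1 (cid2 (bP i j)).
have M0 i j : 0 <= M i j by rewrite /M; case: cid2.
have Mle i j : \forall x \near 0, `|Gamma x (e i) (e j)| <= M i j
  by rewrite /M; case: cid2.
exists (\sum_i \sum_j k * (k * M i j)).
  by do 2!(apply: sumr_ge0 => ? _); rewrite !mulr_ge0.
near=> x => u v.
have Ux : U x by near: x; exact: open_nbhs_nbhs.
have xM : forall i j, `|Gamma x (e i) (e j)| <= M i j.
  by near: x; do 2!(apply: filter_forall => ?); exact: Mle.
rewrite (linear_field_coord fr (smooth_linear_Gamma_l conn v) u Ux).
rewrite (le_trans (ler_norm_sum _ _ _)) // !mulr_suml; apply: ler_sum => i _.
rewrite normrZ (linear_field_coord fr (smooth_linear_Gamma_r fr oU conn
  (smooth_on_cst (e i))) v Ux).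
rewrite (le_trans (ler_wpM2l _ (ler_norm_sum _ _ _))) // mulr_sumr !mulr_suml.
apply: ler_sum => j _; rewrite normrZ.
apply: (@le_trans _ _ ((k * `|u|) * ((k * `|v|) * M i j))).
  by apply: ler_pM => //; [exact: mulr_ge0|apply: ler_pM => //; exact: xM].
by rewrite !mulrA [leLHS](ACl (1*3*5*2*4)%AC).
Unshelve. all: by end_near. Qed.

Lemma iter_nabla_eq (X : V) k (F G : V -> V) p : (forall x, U x -> F x =
  G x) -> U p ->
  iter k (nabla Gamma (cst X)) F p = iter k (nabla Gamma (cst X)) G p.
Proof.
move=> FG; elim: k p => [|k IH] p Up /=; first exact: FG.
by rewrite !nablaE (derive_eq_on X oU IH Up) IH.
Qed.

Lemma iter_nabla_sum (X : V) k (I : Type) (r : seq I) (a : I -> R) (F : I ->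
  V -> V) p :
  (forall i, smooth_on U (F i)) -> U p ->
  iter k (nabla Gamma (cst X)) (fun x => \sum_(i <- r) a i *: F i x) p =
  \sum_(i <- r) a i *: iter k (nabla Gamma (cst X)) (F i) p.
Proof.
move=> sF Up; elim: r => [|i r IH].
  rewrite big_nil (@iter_nabla_eq _ _ _ (cst 0)) // => [|x _]; last
    by rewrite big_nil.
  elim: k p Up => //= k IH p Up.
  rewrite nablaE (derive_eq_on X oU (g := cst 0)) // derive_cst add0r IH //.
  exact: linear_fun0 (Gamma_linear_r conn X Up).
have sS : smooth_on U (fun x => \sum_(j <- r) a j *: F j x).
  apply: smooth_on_sum => // j; apply: (smooth_on_scale (a := cst _)) => //;
    exact: smooth_on_cst.
rewrite big_cons -IH addrC -(iter_nabla_lin fr oU conn) //.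
by apply: iter_nabla_eq => // x _; rewrite big_cons addrC.
Qed.

(** Only finitely many fields matter: expanding the innermost N in the frame reduces to the fields
    nabla_(e_i) B and yields one factor |X|, on a neighbourhood that does not depend on [X]. *)
Lemma iter_nabla_bounded k (B : V -> V) : smooth_on U B ->
  exists2 C : R, 0 <= C &
  \forall x \near 0, forall X, `|iter k (nabla Gamma (cst X)) B x| <=
    C * `|X| ^+ k.
Proof.
elim: k B => [|k IH] B sB.
  have [M M0 Mle] := near0_bounded sB; exists M => //.
  by apply: filterS Mle => x le X; rewrite expr0 mulr1.
have sN i : smooth_on U (nabla Gamma (cst (e i)) B).
  by apply: (smooth_nabla fr oU conn) => //; exact: smooth_on_cst.
have bP i := IH _ (sN i).
pose M i := projT1 (cid2 (bP i)).
have M0 i : 0 <= M i by rewrite /M; case: cid2.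
have Mle i : \forall x \near 0, forall X,
  `|iter k (nabla Gamma (cst X)) (nabla Gamma (cst (e i)) B) x|
  <= M i * `|X| ^+ k by rewrite /M; case: cid2.
have [l l0 lle] := frame_lipschitz fr.
exists (\sum_i l * M i); first by apply: sumr_ge0 => i _; rewrite mulr_ge0.
near=> x => X.
have Ux : U x by near: x; exact: open_nbhs_nbhs.
have xM : forall i X, `|iter k (nabla Gamma (cst X)) (nabla Gamma (cst (e i))
  B) x| <= M i * `|X| ^+ k.
  by near: x; apply: filter_forall => ?; exact: Mle.
have NX y : U y -> nabla Gamma (cst X) B y =
  \sum_i c i X *: nabla Gamma (cst (e i)) B y.
  move=> Uy; have [_ cE _] := fr.
  have lN : linear (fun Z => nabla Gamma (cst Z) B y).
    move=> a u v; rewrite !nablaE (smooth_linear_derive sB).1 //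
      (Gamma_linear_l conn _ Uy).
    by rewrite scalerDr addrACA.
  by rewrite {1}(cE X) (linear_sum_fun _ _ _ lN).
rewrite iterSr (iter_nabla_eq _ _ NX Ux) iter_nabla_sum //.
rewrite (le_trans (ler_norm_sum _ _ _)) // mulr_suml; apply: ler_sum => i _.
rewrite normrZ exprS mulrA [leRHS](_ : _ = (l * `|X|) * (M i * `|X| ^+ k)).
  by rewrite ler_pM.
by rewrite -!mulrA; congr (_ * _); rewrite mulrCA.
Unshelve. all: by end_near. Qed.

End Bounds.

(** * Parallel transport *)

Section Transport.
Context {R : realType} {V : normedModType R}.
Context {n : nat} {e : 'I_n -> V} {c : 'I_n -> {linear V -> R^o}}.
Context (fr : dual_frame e c) {U : set V} (oU : open U) (U0 : U 0).
Context {Gamma : V -> V -> V -> V} (conn : connection U Gamma).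
Context (G0 : forall u v, Gamma 0 u v = 0).
Context {Phi : V -> V -> V} (Phi_bpt : backward_parallel_transport U Gamma Phi).

(** On the ball of radius [delta] a parallel field has derivative at most C delta times its maximum;
    [dK] then limits its variation over unit time to half of that maximum. *)
Context {K C delta : R} (K0 : 0 <= K) (C0 : 0 <= C) (d0 : 0 < delta).
Context (mv : mean_value_const (V := V) K).
Context (dU : forall x, `|x| < delta -> U x).
Context (dG : forall x, `|x| < delta -> forall u v, `|Gamma x u v| <=
  C * `|u| * `|v|).
Context (dK : K * C * delta <= 2^-1).

Definition solution (x : V) (W : R -> V) := forall t : R, 0 <= t <= 1 ->
  is_derive t (1 : R) W (- Gamma (t *: x) x (W t)).

Lemma solutionP x W : parallel_along Gamma (ray x) W <-> solution x W.
Proof.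
split=> H t t01; have := H t t01; rewrite /nabla_along derive1_ray derive1E.
  move=> [dW /eqP]; rewrite addr_eq0 => /eqP E; split=> //.
by move=> [dW E]; split=> //; rewrite E addNr.
Qed.

Lemma ray_small (x : V) (t : R) : `|x| < delta -> 0 <= t <= 1 ->
  `|t *: x| < delta.
Proof.
move=> xd /andP[t0 t1]; apply: le_lt_trans xd.
by rewrite normrZ ger0_norm // ler_piMl.
Qed.

(** At a point s where |W| is maximal, |W s - W r0| <= |W s| / 2, hence |W s| <= 2 |W r0|. This
    takes the place of a Gronwall estimate. *)
Lemma solution_bound (x : V) W (r r0 : R) : `|x| < delta -> solution x W ->
  0 <= r <= 1 -> 0 <= r0 <= 1 -> `|W r| <= 2 * `|W r0|.
Proof.
move=> xd sW r01 r001.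
have cW : {within `[0 : R, 1], continuous (fun t => `|W t|)}.
  apply: continuous_in_subspaceT => t; rewrite inE /= in_itv /= => t01.
  have [dW _] := sW t t01.
  apply: (@continuous_comp _ _ _ W (fun v => `|v|));
    last exact: norm_continuous.
  exact/differentiable_continuous/derivable1_diffP.
have [s s01 smax] := EVT_max ler01 cW.
rewrite in_itv /= in s01.
have {}smax t : 0 <= t <= 1 -> `|W t| <= `|W s| by move=> t01; apply: smax;
  rewrite in_itv.
have dle t : 0 <= t <= 1 -> `|- Gamma (t *: x) x (W t)| <= C * delta * `|W s|.
  move=> t01; rewrite normrN (le_trans (dG (ray_small xd t01) _ _)) //.
  by rewrite ler_pM ?mulr_ge0 // ?ler_wpM2l ?(ltW xd) //; exact: smax.
have half a b : 0 <= a -> a <= b -> b <= 1 -> `|W b - W a| <= 2^-1 * `|W s|.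
  move=> a0 ab b1.
  have sub t : a <= t <= b -> 0 <= t <= 1.
    by move=> /andP[at_ tb]; rewrite (le_trans a0 at_) (le_trans tb b1).
  have H := mv ab (fun t tab => sW t (sub t tab)) (fun t tab =>
    dle t (sub t tab)).
  apply: le_trans H _; rewrite -[leRHS]mulr1 ler_pM ?subr_ge0 //.
  - by rewrite !mulr_ge0 // ltW.
  - by rewrite !mulrA ler_wpM2r.
  - by rewrite lerBlDl (le_trans b1) // lerDr.
have /andP[s0 s1] := s01; have /andP[r0' r1'] := r001.
have : `|W s - W r0| <= 2^-1 * `|W s|.
  by have [sr|/ltW rs] := leP s r0; [rewrite distrC|]; exact: half.
move=> le; apply: le_trans (smax _ r01) _.
have : `|W s| <= `|W s - W r0| + `|W r0|
  by rewrite -{1}[W s](subrK (W r0)) ler_normD.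
move/le_trans/(_ (lerD le (lexx _))); rewrite -lerBlDl.
have -> : `|W s| - 2^-1 * `|W s| = 2^-1 * `|W s|.
  by rewrite -{1}[`|W s|]mul1r -mulrBl [X in X - _](splitr 1) mul1r addrK.
by rewrite ler_pdivrMl.
Qed.

Lemma solution_lin x a W1 W2 : `|x| < delta -> solution x W1 -> solution x W2 ->
  solution x (fun t => a *: W1 t + W2 t).
Proof.
move=> xd s1 s2 t t01; have Ut := dU (ray_small xd t01).
have i1 := s1 t t01; have i2 := s2 t t01.
have := is_deriveD (is_deriveZ a i1) i2; rewrite scalerN -opprD.
by rewrite -(Gamma_linear_r conn x Ut).
Qed.

Lemma solution_uniq (x : V) W1 W2 (r r0 : R) : `|x| < delta ->
  solution x W1 -> solution x W2 ->
  0 <= r <= 1 -> 0 <= r0 <= 1 -> W1 r0 = W2 r0 -> W1 r = W2 r.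
Proof.
move=> xd s1 s2 r01 r001 E; have s3 := solution_lin (-1) xd s2 s1.
have := solution_bound xd s3 r01 r001; rewrite E !scaleN1r addNr normr0 mulr0.
by rewrite normr_le0 addrC subr_eq0 => /eqP.
Qed.

Lemma Phi_solution (x Y : V) : `|x| < delta ->
  exists W, [/\ solution x W, W 1 = Y & W 0 = Phi x Y].
Proof.
move=> xd; have [W [pW W1 W0]] := Phi_bpt Y (dU xd).
by exists W; split=> //; exact/solutionP.
Qed.

Lemma in01 : ((0 : R) <= 0 <= (1 : R)) * ((0 : R) <= 1 <= (1 : R)).
Proof. by rewrite !lexx ler01. Qed.

Lemma Phi_linear (x : V) : `|x| < delta -> linear (Phi x).
Proof.
move=> xd a u v.
have [W1 [s1 e1 <-]] := Phi_solution u xd; have [W2 [s2 e2 <-]] :=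
  Phi_solution v xd.
have [W3 [s3 e3 <-]] := Phi_solution (a *: u + v) xd.
apply: (solution_uniq xd s3 (solution_lin a xd s1 s2) _ _ (r0 := 1));
  rewrite ?in01 //.
by rewrite e1 e2 e3.
Qed.

Lemma Phi_bound (x Y : V) : `|x| < delta -> `|Phi x Y| <= 2 * `|Y|.
Proof.
move=> xd; have [W [sW <- <-]] := Phi_solution Y xd.
by apply: (solution_bound xd sW); rewrite in01.
Qed.

Lemma Phi_inj (x Y : V) : `|x| < delta -> Phi x Y = 0 -> Y = 0.
Proof.
move=> xd; have [W [sW <- <-]] := Phi_solution Y xd => W0.
have := solution_bound xd sW in01.2 in01.1.
by rewrite W0 normr0 mulr0 normr_le0 => /eqP.
Qed.

Lemma injective_linear_surjective (f : V -> V) : linear f ->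
  (forall v, f v = 0 -> v = 0) -> forall y, exists v, f v = y.
Proof.
move=> lf finj y; have [_ cE cD] := fr.
pose M := \matrix_(i, j) (c j (f (e i)) : R).
have MP (x : 'rV[R]_n) : f (comb e x) = comb e (x *m M).
  rewrite /comb (linear_sum_fun _ _ _ lf) [LHS]cE; apply: eq_bigr => j _;
    congr (_ *: _).
  rewrite linear_sum mxE; apply: eq_bigr => i _; by rewrite linearZ mxE.
have Mfree : row_free M.
  apply: inj_row_free => x xM; have := MP x; rewrite xM linear0 => /finj x0.
  apply/rowP => j; rewrite mxE; have := congr1 (c j) x0.
  rewrite linear0 /comb linear_sum (bigD1 j) //= big1 => [|i ij];
    rewrite linearZ /= cD.
    by rewrite eqxx addr0 => <-; rewrite -[RHS]/(_ * _) mulr1.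
  by rewrite eq_sym (negbTE ij) scaler0.
have Mu : M \in unitmx by rewrite -row_free_unit.
exists (comb e ((\row_i (c i y : R)) *m invmx M)).
rewrite MP mulmxKV // /comb [RHS]cE; apply: eq_bigr => i _; by rewrite mxE.
Qed.

(** The initial value problem is solved backwards: transport to 0 is linear and injective, hence
    onto in finite dimension, so some end value is carried to [v]. *)
Lemma forward_solution (x v : V) : `|x| < delta -> exists W, solution x W /\
  W 0 = v.
Proof.
move=> xd; have [Y PY] :=
  injective_linear_surjective (Phi_linear xd) (fun Y => Phi_inj xd) v.
by have [W [sW _ W0]] := Phi_solution Y xd; exists W; rewrite W0.
Qed.

Lemma solution_scale x W s : solution x W -> `|x| < delta -> 0 <= s <= 1 ->
  solution (s *: x) (fun t => W (s * t)).
Proof.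
move=> sW xd s01 t t01.
have st01 : 0 <= s * t <= 1.
  by case/andP: s01 => s0 s1; case/andP: t01 => t0 t1;
    rewrite mulr_ge0 // mulr_ile1.
have Ut := dU (ray_small xd st01).
have := is_derive_cst_line (sW _ st01).
rewrite scalerN -(linear_funZ _ _ (Gamma_linear_l conn _ Ut)).
by rewrite scalerA mulrC.
Qed.

(** The initial piece of a solution along [x], reparametrized, is a solution along [s *: x];
    uniqueness identifies it with the one defining [Phi]. *)
Lemma Phi_along x W s : solution x W -> `|x| < delta -> 0 <= s <= 1 ->
  Phi (s *: x) (W s) = W 0.
Proof.
move=> sW xd s01; have sxd := ray_small xd s01.
have [W' [sW' e1 <-]] := Phi_solution (W s) sxd.
rewrite -[in RHS](mulr0 s).
apply: (solution_uniq sxd sW' (solution_scale sW xd s01) _ _ (r0 := 1));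
  rewrite ?in01 //.
by rewrite mulr1.
Qed.

Lemma solution_rescale (X : V) W (a s : R) : a != 0 -> `|a *: X| < delta ->
  solution (a *: X) W -> 0 <= a^-1 * s <= 1 ->
  is_derive s (1 : R) (fun t =>
    W (a^-1 * t)) (- Gamma (s *: X) X (W (a^-1 * s))) /\
  Phi (s *: X) (W (a^-1 * s)) = W 0.
Proof.
move=> a0 aX sW s01.
have E : (a^-1 * s) *: (a *: X) = s *: X
  by rewrite scalerA mulrAC mulVf // mul1r.
have Ut := dU (ray_small aX s01); rewrite E in Ut.
split; last by rewrite -E; exact: Phi_along.
have := is_derive_cst_line (sW _ s01).
rewrite E scalerN -(linear_funZ _ _ (Gamma_linear_l conn _ Ut)).
by rewrite scalerA mulVf // scale1r.
Qed.

(** A derivative at 0 is two-sided, whereas solutions live on [0, 1]. Forward solutions along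
    [h *: X] and [(- h) *: X] are rescaled and glued at 0. *)
Lemma parallel_frame (X v : V) (h : R) : 0 < h -> h * `|X| < delta ->
  exists W : R -> V, forall s, `|s| < h -> Phi (s *: X) (W s) = v /\
    is_derive s (1 : R) W (- Gamma (s *: X) X (W s)).
Proof.
move=> h0 hX; have hN0 := lt0r_neq0 h0; have hN0' : - h != 0
  by rewrite oppr_eq0.
have dp : `|h *: X| < delta by rewrite normrZ ger0_norm // ltW.
have dm : `|(- h) *: X| < delta by rewrite scaleNr normrN.
have [Wp [sp vp]] := forward_solution v dp; have [Wm [sm vm]] :=
  forward_solution v dm.
pose Fp s := Wp (h^-1 * s); pose Fm s := Wm ((- h)^-1 * s).
have rp s : `|s| < h -> 0 <= s -> 0 <= h^-1 * s <= 1.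
  move=> /ltr_normlP[_ sh] s0; apply/andP; split.
    by rewrite mulr_ge0 // invr_ge0 ltW.
  by rewrite ler_pdivrMl // mulr1 ltW.
have rm s : `|s| < h -> s <= 0 -> 0 <= (- h)^-1 * s <= 1.
  by move=> sh s0; rewrite invrN mulNr -mulrN rp // ?normrN // oppr_ge0.
exists (fun s => if 0 <= s then Fp s else Fm s) => s sh.
have [s0|s0|s0] := ltgtP 0 s.
- have [dF PF] := solution_rescale hN0 dp sp (rp s sh (ltW s0)); split;
  first by rewrite PF.
  apply: near_eq_is_derive dF; near=> t.
  suff -> : 0 <= t by [].
  by apply: ltW; near: t; apply: open_nbhs_nbhs; split=> //; exact: open_gt.
- have [dF PF] := solution_rescale hN0' dm sm (rm s sh (ltW s0)); split;
  first by rewrite PF.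
  apply: near_eq_is_derive dF; near=> t.
  suff /lt_geF -> : t < 0 by [].
  by near: t; exact: lt_nbhsl.
- subst s; have [dF PF] := solution_rescale hN0 dp sp (rp 0 sh (lexx 0)).
  have [dF' _] := solution_rescale hN0' dm sm (rm 0 sh (lexx 0)).
  split; first by rewrite PF.
  have E : Fp 0 = Fm 0 by rewrite /Fp /Fm !mulr0 vp vm.
  by apply: is_derive_glue => //; rewrite E; exact: dF'.
Unshelve. all: by end_near. Qed.

Lemma Phi0 Y : Phi 0 Y = Y.
Proof.
have z : `|0 : V| < delta by rewrite normr0.
have [W [sW <- <-]] := Phi_solution Y z.
have dle (t : R) : 0 <= t <= 1 -> `|- Gamma (t *: 0) 0 (W t)| <= 0.
  by move=> _; rewrite scaler0 G0 oppr0 normr0.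
have := mv ler01 sW dle.
by rewrite mulr0 mul0r normr_le0 subr_eq0 => /eqP ->.
Qed.

(* Writing constants as values of parallel fields turns a difference quotient
   into [Phi] of a difference quotient in a fixed tangent space. *)
Lemma is_derive_Phi_neq0 (X : V) (s0 : R) (B : V -> V) : X != 0 ->
  `|s0 *: X| < delta ->
  smooth_on U B ->
  is_derive (s0 *: X) X (fun x => Phi x (B x))
    (Phi (s0 *: X) (nabla Gamma (cst X) B (s0 *: X))).
Proof.
move=> X0 xd sB; set x0 := s0 *: X; set d := nabla _ _ _ _.
have nX : 0 < `|X| by rewrite normr_gt0.
have s0d : `|s0| < delta / `|X| by rewrite ltr_pdivlMr // -normrZ.
(* A midpoint, so that [s0] lies inside the parameter interval and the whole interval stays in the
   ball. *)
pose h := (`|s0| + delta / `|X|) / 2.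
have sh : `|s0| < h by rewrite midf_lt.
have hX : h * `|X| < delta by rewrite -ltr_pdivlMr // midf_lt.
have h0 : 0 < h by exact: le_lt_trans sh.
have [W PW] := parallel_frame (Phi x0 (B x0)) h0 hX.
have [W' PW'] := parallel_frame (Phi x0 d) h0 hX.
have Phi_eq u v : Phi x0 u = Phi x0 v -> u = v.
  move=> E; apply/eqP; rewrite -subr_eq0; apply/eqP; apply: (Phi_inj xd).
  by rewrite (linear_funB _ _ (Phi_linear xd)) E subrr.
have W0 : W s0 = B x0 by apply: Phi_eq; have [] := PW s0 sh.
have W'0 : W' s0 = d by apply: Phi_eq; have [] := PW' s0 sh.
(* As [W] is parallel and equals [B] at [s0], the ordinary derivative of the difference is the
   covariant derivative of [B]. *)
have dG' : is_derive s0 (1 : R) (fun s => B (s *: X) - W s) d.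
  have E : d = 'D_X B x0 - (- Gamma x0 X (W s0)) by rewrite opprK W0.
  rewrite E; apply: is_deriveB; last by have [] := PW s0 sh.
  have := smooth_on_is_derive X sB (dU xd);
    rewrite -[X in is_derive X](addr0 x0) => H.
  have := is_derive_line H; rewrite (_ : (fun s => B (s *: X + 0)) = fun s =>
    B (s *: X)) ?addr0 //.
  by apply/funext => s; rewrite addr0.
apply/is_derive_lineP/is_derive1P => eps eps0.
(* A quarter of [eps]: two error terms, and the factor 2 of [Phi_bound]. *)
have e4 : 0 < eps / 2 / 2 by rewrite !divr_gt0.
have n1 := (is_derive1P _ _ _).1 dG' _ e4.
have cW' : {for s0, continuous W'}.
  apply/differentiable_continuous/derivable1_diffP.
  by have [_ [dW' _]] := PW' s0 sh.
have n2 : \forall t \near (0 : R), `|d - W' (t + s0)| <= eps / 2 / 2.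
  have ct : t + s0 @[t --> (0 : R)] --> 0 + s0 by apply: cvgD;
    [exact: cvg_id|exact: cvg_cst].
  rewrite add0r in ct; have /cvgrPdist_le/(_ _ e4) := cvg_comp _ _ ct cW'.
  by rewrite W'0.
have n3 : \forall t \near (0 : R), `|t + s0| < h.
  have ct : `|t + s0| @[t --> (0 : R)] --> `|0 + s0|.
    by apply: cvg_norm; apply: cvgD; [exact: cvg_id|exact: cvg_cst].
  rewrite add0r in ct; exact: (cvgr_lt _ ct).
near=> t.
have le1 : `|B ((t + s0) *: X) - W (t +
  s0) - (B (s0 *: X) - W s0) - t *: d| <= eps / 2 / 2 * `|t|.
  by near: t; exact: n1.
have le2 : `|d - W' (t + s0)| <= eps / 2 / 2 by near: t; exact: n2.
have th : `|t + s0| < h by near: t; exact: n3.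
rewrite W0 subrr subr0 in le1.
rewrite addr0 scale0r add0r; set y := t *: X + x0.
have yE : y = (t + s0) *: X by rewrite scalerDl.
have yd : `|y| < delta.
  by rewrite yE normrZ (le_lt_trans _ hX) // ler_wpM2r // ltW.
have [+ _] := PW _ th; have [+ _] := PW' _ th; rewrite -yE => <- <-.
rewrite -(linear_funZ _ _ (Phi_linear yd)) -!(linear_funB _ _ (Phi_linear yd)).
apply: le_trans (Phi_bound _ yd) _; rewrite -ler_pdivlMl //.
have -> : B y - W (t + s0) - t *: W' (t + s0) =
    (B y - W (t + s0) - t *: d) + t *: (d - W' (t + s0)).
  by rewrite scalerBr addrA subrK.
apply: le_trans (ler_normD _ _) _; rewrite {1}yE.
have -> : 2^-1 * (eps * `|t|) = eps / 2 / 2 * `|t| + `|t| * (eps / 2 / 2).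
  by rewrite [X in _ = _ + X]mulrC -mulrDl -splitr mulrCA mulrA.
by rewrite lerD // normrZ ler_wpM2l.
Unshelve. all: by end_near. Qed.

Lemma is_derive_Phi (X : V) (s0 : R) (B : V -> V) : `|s0 *: X| < delta ->
  smooth_on U B ->
  is_derive (s0 *: X) X (fun x => Phi x (B x))
    (Phi (s0 *: X) (nabla Gamma (cst X) B (s0 *: X))).
Proof.
have [->|X0] := eqVneq X 0; last exact: is_derive_Phi_neq0.
move=> xd sB; apply: (is_derive_eq (is_derive0 _ _)).
rewrite nablaE derive0 add0r (linear_fun0 (Gamma_linear_l conn _ (dU xd))).
by rewrite (linear_fun0 (Phi_linear xd)).
Qed.

Lemma is_derive_near_line (X : V) (s0 : R) (f g : V -> V) d :
  (forall s, `|s *: X| < delta -> f (s *: X) = g (s *: X)) ->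
    `|s0 *: X| < delta ->
  is_derive (s0 *: X) X f d -> is_derive (s0 *: X) X g d.
Proof.
move=> fg xd /is_derive_lineP df; apply/is_derive_lineP.
apply: near_eq_is_derive df.
have ct : `|t *: X + s0 *: X| @[t --> (0 : R)] --> `|0 *: X + s0 *: X|.
  by apply: cvg_norm; apply: cvgD; [exact: scalel_continuous|exact: cvg_cst].
rewrite scale0r add0r in ct; have nt : \forall t \near (0 : R), `|t *: X +
  s0 *: X| < delta by exact: (cvgr_lt _ ct).
near=> t; rewrite -scalerDl; apply: fg; rewrite scalerDl; near: t; exact: nt.
Unshelve. all: by end_near.
Qed.

Section TaylorPhi.
Context (X Y : V).
Notation N := (nabla Gamma (cst X)).

Let smooth_iter k : smooth_on U (iter k N (cst Y)).
Proof. apply: (smooth_iter_nabla_cst fr oU conn); exact: smooth_on_cst. Qed.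

Lemma iter_derive_Phi k (s : R) : `|s *: X| < delta ->
  iter_derive (nseq k X) (fun x => Phi x Y) (s *: X) =
    Phi (s *: X) (iter k N (cst Y) (s *: X)).
Proof.
elim: k s => [//|k IH] s xd.
have dP := is_derive_Phi xd (smooth_iter k).
have sym t (td : `|t *: X| < delta) := esym (IH t td).
exact: (@derive_val _ _ _ _ _ _ _ (is_derive_near_line sym xd dP)).
Qed.

Lemma is_derive_iter_Phi k (s : R) : `|s *: X| < delta ->
  is_derive (s *: X) X (iter_derive (nseq k X) (fun x => Phi x Y))
    (Phi (s *: X) (iter k.+1 N (cst Y) (s *: X))).
Proof.
move=> xd; apply: (is_derive_near_line _ xd (is_derive_Phi xd (smooth_iter k))).
by move=> t td; rewrite iter_derive_Phi.
Qed.

(** Along the segment the functions [phi k] are successive derivatives of one another, and [Phi 0]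
    is the identity, so their values at 0 are the vectors N^k Y. *)
Lemma taylor_Phi m (M : R) : `|X| < delta -> 0 <= M ->
  (forall s, 0 <= s <= 1 -> `|iter m N (cst Y) (s *: X)| <= M) ->
  `|Phi X Y - \sum_(k < m) k`!%:R^-1 *: iter k N (cst Y) 0| <= K ^+ m * (2 * M).
Proof.
move=> Xd M0 le.
pose phi k (s : R) := Phi (s *: X) (iter k N (cst Y) (s *: X)).
have dphi k (s : R) : 0 <= s <= 1 -> is_derive s (1 : R) (phi k) (phi k.+1 s).
  move=> s01; have sd := ray_small Xd s01.
  have := is_derive_Phi sd (smooth_iter k);
    rewrite -[X in is_derive X](addr0 (s *: X)) => H.
  have := is_derive_line H; rewrite (_ : (fun s => _) = phi k) ?addr0 //.
  by apply/funext => t; rewrite addr0.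
have le' (s : R) : 0 <= s <= 1 -> `|phi m s| <= 2 * M.
  move=> s01; apply: le_trans (Phi_bound _ (ray_small Xd s01)) _.
  by rewrite ler_wpM2l // le.
have M20 : 0 <= 2 * M by rewrite mulr_ge0.
have := taylor_inequality K0 mv M20 dphi le' in01.2.
rewrite {1}/phi scale1r; congr (`|_ - _| <= _); apply: eq_bigr => k _.
by rewrite expr1n mul1r /phi scale0r Phi0.
Qed.

End TaylorPhi.
End Transport.

(** Torsion-freeness is tested on constant fields, whose bracket vanishes. *)
Lemma torsion_free_symmetric (R : realType) (V : normedModType R) (U : set V)
    (g : V -> V -> V -> R) (Gamma : V -> V -> V -> V) (x u v : V) :
  levi_civita U g Gamma -> U x -> Gamma x u v = Gamma x v u.
Proof.
move=> lc Ux.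
have := levi_civita_torsion_free lc (smooth_on_cst u) (smooth_on_cst v) Ux.
rewrite !nablaE /lie_bracket !derive_cst !add0r oppr0 => /eqP.
by rewrite subr_eq0 => /eqP.
Qed.

(** The geodesic equation of the ray of [x] at time 1, where the velocity has zero ordinary
    derivative. *)
Lemma normal_coordinates_diag (R : realType) (V : normedModType R) (U : set V)
    (Gamma : V -> V -> V -> V) (x : V) :
  normal_coordinates U Gamma -> U x -> Gamma x x x = 0.
Proof.
move=> nc Ux; have [_ /(_ 1)] := nc x Ux.
rewrite /nabla_along derive1_ray derive1_cst add0r /ray scale1r ler01 lexx.
by move=> /(_ erefl) [].
Qed.

Theorem proposition3 (R : realType) (V : normedModType R)
    (U : set V) (g : V -> V -> V -> R) (Gamma : V -> V -> V -> V)
    (Phi_inv : V -> V -> V) :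
  finite_dim V ->
  open U -> U 0 -> star_shaped U ->
  riemannian_metric U g ->
  levi_civita U g Gamma ->
  normal_coordinates U Gamma ->
  backward_parallel_transport U Gamma Phi_inv ->
  (forall (k : nat) (X Y : V),
     iter_nabla Gamma (nabla Gamma) (cst Y) (k := k) (fun=> cst X) 0 =
     free_eval (fun j => symm_nabla_curvature Gamma j X) (Qtilde k) Y) /\
  (forall Y : V,
     has_taylor_expansion (fun X => Phi_inv X Y)
       (fun k X => k`!%:R^-1 *:
          free_eval (fun j => symm_nabla_curvature Gamma j X) (Qtilde k) Y)).
Proof.
move=> fd oU U0 _ _ lc nc bpt.
have [n [e [c fr]]] := dual_frame_exists fd.
have conn := levi_civita_connection lc.
have Gsym x u v : U x -> Gamma x u v = Gamma x v u
  by exact: torsion_free_symmetric lc.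
have Gxx x : U x -> Gamma x x x = 0 by exact: normal_coordinates_diag nc.
have G0 u v := Gamma0 oU U0 conn Gsym Gxx u v.
have evalE k X Y : iter k (nabla Gamma (cst X)) (cst Y) 0 =
    free_eval (fun j => symm_nabla_curvature Gamma j X) (Qtilde k) Y.
  apply: (free_eval_Qtilde_unique (w := fun k =>
    iter k (nabla Gamma (cst X)) (cst Y) 0)) => //.
  - exact: (symm_nabla_curvature_linear fr oU U0 conn Gsym Gxx X).
  - exact: (iter_nabla_cst1 oU U0 conn Gsym Gxx X Y).
  - exact: (iter_nabla_cst_rec fr oU U0 conn Gsym Gxx X Y).
split=> [k X Y|Y].
  rewrite -evalE; apply: (iter_nabla_section fr oU conn).
    by move=> p; exact: (Gamma_ray oU U0 conn Gsym Gxx).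
  by split=> //; exists 0; rewrite scale0r.
have [K K0 mv] := mean_value_ineq fr.
have [C C0 nearG] := Gamma_bounded fr oU U0 conn.
have nearU : \forall x \near (0 : V), U x by exact: open_nbhs_nbhs.
have nearUG : \forall x \near (0 : V), U x /\
    forall u v, `|Gamma x u v| <= C * `|u| * `|v| by exact: filterI.
have /nbhs_norm0P[r /= r0 rP] := nearUG.
have KC0 : 0 < 2 * (K * C + 1) by rewrite mulr_gt0 // ltr_wpDl // mulr_ge0.
(* The second bound gives K C delta <= 1/2; the added 1 keeps the denominator positive when K C =
   0. *)
pose delta := Num.min r (2 * (K * C + 1))^-1.
have d0 : 0 < delta by rewrite lt_min r0 invr_gt0.
have dU x : `|x| < delta -> U x by rewrite lt_min => /andP[xr _];
  exact: (rP x xr).1.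
have dG x : `|x| < delta -> forall u v, `|Gamma x u v| <= C * `|u| * `|v|.
  by rewrite lt_min => /andP[xr _]; exact: (rP x xr).2.
have dK : K * C * delta <= 2^-1.
  apply: (@le_trans _ _ (K * C * (2 * (K * C + 1))^-1)).
    by rewrite ler_wpM2l ?mulr_ge0 // ge_min lexx orbT.
  by rewrite ler_pdivrMr // [leRHS]mulrA mulVf ?pnatr_eq0 // mul1r lerDl.
have iterD := is_derive_iter_Phi fr oU conn bpt K0 C0 d0 mv dU dG dK.
have iterE := iter_derive_Phi fr oU conn bpt K0 C0 d0 mv dU dG dK.
have taylor := taylor_Phi fr oU conn G0 bpt K0 C0 d0 mv dU dG dK.
have Phi0Y := Phi0 G0 bpt d0 mv dU.
split=> [k X|k X|N].
- near=> t; have td : `|t *: X| < delta.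
    near: t; have ct : `|t *: X| @[t --> (0 : R)] --> `|0 *: X|.
      by apply: cvg_norm; exact: scalel_continuous.
    by rewrite scale0r normr0 in ct; exact: (cvgr_lt _ ct).
  exact: (@ex_derive _ _ _ _ _ _ _ (iterD X Y k t td)).
- rewrite /taylor_part -[X in iter_derive _ _ X](scale0r X) iterE.
    by rewrite scale0r Phi0Y evalE.
  by rewrite scale0r normr0.
(* One order beyond the polynomial: a remainder O(|X|^(N+1)) is o(|X|^N). *)
have [M M0 nearM] := iter_nabla_bounded fr oU U0 conn N.+1 (smooth_on_cst Y).
have /nbhs_norm0P[s /= s0 sP] := nearM.
apply/eqoP => eps eps0.
pose A := K ^+ N.+1 * (2 * M).
have A0 : 0 <= A by rewrite !mulr_ge0 // exprn_ge0.
have normlt (m : R) : 0 < m -> \forall X \near (0 : V), `|X| < m.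
  by move=> m0; apply/nbhs_norm0P; exists m.
near=> X.
have Xd : `|X| < delta by near: X; exact: normlt.
have Xs : `|X| < s by near: X; exact: normlt.
(* The remainder is at most A |X| |X|^N; A may be 0, hence the 1. *)
have Xe : `|X| < eps / (A + 1).
  by near: X; apply: normlt; rewrite divr_gt0 // ltr_wpDl.
have sX (t : R) : 0 <= t <= 1 -> `|t *: X| < s.
  by move=> /andP[t0 t1]; rewrite (le_lt_trans _ Xs) // normrZ ger0_norm //
    ler_piMl.
have H := taylor X Y N.+1 (M * `|X| ^+ N.+1) Xd (mulr_ge0 M0 (exprn_ge0 _
  (normr_ge0 X)))
  (fun t t01 => sP _ (sX t t01) X).
have <- : Phi_inv X Y - \sum_(k < N.+1) k`!%:R^-1 *: iter k (nabla Gamma (cst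
  X)) (cst Y) 0 =
    Phi_inv X Y - \sum_(k < N.+1) k`!%:R^-1 *:
      free_eval (fun j => symm_nabla_curvature Gamma j X) (Qtilde k) Y.
  by congr (_ - _); apply: eq_bigr => k _; rewrite evalE.
apply: le_trans H _; rewrite normrX normr_id.
have -> : K ^+ N.+1 * (2 * (M * `|X| ^+ N.+1)) = A * `|X| * `|X| ^+ N.
  by rewrite /A [`|X| ^+ _]exprS !mulrA.
rewrite ler_wpM2r ?exprn_ge0 //.
apply: (@le_trans _ _ ((A + 1) * `|X|)); first by rewrite ler_wpM2r // lerDl.
by rewrite mulrC -ler_pdivlMr ?ltr_wpDl // ltW.
Unshelve. all: by end_near. Qed.
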